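(* Let $G$ be a countable Moore group. Then every left Følner sequence $(F_n)$ in $G$ is a strong sequence for every unitary representation $(\mathcal{H},\pi)$ of $G$, that is, for every $v\in\mathcal{H}$, $$\lim_n \frac{1}{|F_n|}\sum_{s\in F_n}\pi(s)v=P_Gv$$ in the norm topology on $\mathcal{H}$.
   Context: A countable (discrete) group is a Moore group if all of its irreducible unitary representations are finite-dimensional. $P_G$ denotes the orthogonal projection onto the closed subspace of $\pi(G)$-invariant vectors. A sequence $(F_n)$ of (nonempty) finite subsets of $G$ is a left Følner sequence if $\lim_n |F_n\triangle tF_n|/|F_n|=0$ for all $t\in G$. *)

(* Defs.v *)
From HB Require Import structures.
From mathcomp Require Import all_boot all_order all_algebra.
From mathcomp Require Import finmap complex.
From mathcomp Require Import all_classical all_reals all_analysis.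

Set Implicit Arguments.
Unset Strict Implicit.
Unset Printing Implicit Defensive.

Import Order.TTheory GRing.Theory Num.Theory.
Import numFieldNormedType.Exports.

Local Open Scope classical_set_scope.
Local Open Scope ring_scope.
Local Open Scope complex_scope.

(* The inner product [hdot] is linear in its first argument and
   conjugate-linear in the second; the norm [`|x|] is [R[i]]-valued, as for
   every normed module over [R[i]]. *)
Record hilbertType (R : realType) := Hilbert {
  hilbert_sort :> completeNormedModType R[i];
  hdot : {dot hilbert_sort for Num.conj};
  hilbert_normE : forall x : hilbert_sort, `|x| ^+ 2 = hdot x x
}.

Definition linear_subspace (R : realType) (H : hilbertType R) (K : set H) : Prop :=
  submod_closed (mem K).

Definition orthproj_spec (R : realType) (H : hilbertType R) (K : set H)
    (v : H) : set H :=
  [set p | K p /\ forall w, K w -> hdot H (v - p) w = 0].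

(* For a closed subspace [K] of a Hilbert space, [orthproj_spec K v] is a
   singleton, so that the default value [0] is not used. *)
Definition orthproj (R : realType) (H : hilbertType R) (K : set H)
    (v : H) : H :=
  xget 0 (orthproj_spec K v).

Definition finite_dimensional (R : realType) (H : hilbertType R) : Prop :=
  exists (n : nat) (f : {linear H -> 'rV[R[i]]_n}), bijective f.

Definition unitary_op (R : realType) (H : hilbertType R) (u : H -> H) : Prop :=
  bijective u /\ forall x y, hdot H (u x) (u y) = hdot H x y.

Record unitary_rep (R : realType) (G : groupType) (H : hilbertType R) :=
  UnitaryRep {
  rep_fun :> G -> {linear H -> H};
  rep_unitary : forall g, unitary_op (rep_fun g);
  rep1 : forall v, rep_fun 1%g v = v;
  repM : forall g h v, rep_fun (g * h)%g v = rep_fun g (rep_fun h v)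
}.

Definition irreducible_rep (R : realType) (G : groupType) (H : hilbertType R)
    (pi : unitary_rep G H) : Prop :=
  (exists v : H, v != 0) /\
  forall K : set H, closed K -> linear_subspace K ->
    (forall g v, K v -> K (pi g v)) -> K = [set 0] \/ K = [set: H].

Definition moore_group (R : realType) (G : groupType) : Prop :=
  forall (H : hilbertType R) (pi : unitary_rep G H),
    irreducible_rep pi -> finite_dimensional H.

Definition invariants (R : realType) (G : groupType) (H : hilbertType R)
    (pi : unitary_rep G H) : set H :=
  [set v | forall g, pi g v = v].

Definition left_translate (G : groupType) (t : G) (A : {fset G}) : {fset G} :=
  [fset (t * s)%g | s in A]%fset.

Definition symdiff (T : choiceType) (A B : {fset T}) : {fset T} :=
  ((A `\` B) `|` (B `\` A))%fset.

Definition left_folner (R : realType) (G : groupType) (F : nat -> {fset G}) :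
    Prop :=
  (forall n, F n != fset0) /\
  forall t : G,
    ((#|` symdiff (F n) (left_translate t (F n))|%:R / #|` F n|%:R : R)
       @[n --> \oo] --> 0).

Definition rep_average (R : realType) (G : groupType) (H : hilbertType R)
    (pi : unitary_rep G H) (A : {fset G}) (v : H) : H :=
  (#|` A|%:R : R[i])^-1 *: \sum_(s <- A) pi s v.

Definition strong_sequence (R : realType) (G : groupType) (H : hilbertType R)
    (pi : unitary_rep G H) (F : nat -> {fset G}) : Prop :=
  forall v : H,
    rep_average pi (F n) v @[n --> \oo] --> orthproj (invariants pi) v.

(* Main.v *)
Require Import Defs.
From HB Require Import structures.
From mathcomp Require Import all_boot all_order all_algebra.
From mathcomp Require Import finmap complex.
From mathcomp Require Import all_classical all_reals all_analysis.
From mathcomp Require Import ring lra.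

Set Implicit Arguments.
Unset Strict Implicit.
Unset Printing Implicit Defensive.

Import Order.TTheory GRing.Theory Num.Theory.
Import numFieldNormedType.Exports.

Local Open Scope classical_set_scope.
Local Open Scope ring_scope.
Local Open Scope complex_scope.

(* A left Folner sequence always makes the averages [A_n v] asymptotically
   invariant, so only their norm convergence is at stake.  The adjoint averages
   converge strongly by the mean ergodic theorem, hence [A_n v] converges weakly
   in general and in norm when the representation is finite-dimensional.  If
   [A_n v] is not Cauchy for some unit vector [v], the functions
   [phi |-> phi((a_m - a_n)^* (a_m - a_n))] on the compact convex set of states
   of [G] are bounded below along a subsequence at the state of [v].  Simons'
   inequality then produces an extreme state at which they do not tend to [0].
   But the GNS representation of an extreme state is irreducible, hence
   finite-dimensional, and the averages of its cyclic vector converge.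
   Simons' inequality replaces a Choquet decomposition of the state of [v]. *)

(** The difficulty is one of sides. Left invariance of [F n] controls [pi t (A_n v)], and it
    controls the adjoint averages of a coboundary; but [A_n (v - pi t v)] compares [F n] with its
    right translate by [t], about which a left Folner sequence says nothing. The mean ergodic
    argument therefore reaches the adjoints only, and through them it gives weak information on
    [A_n]. A failure to be Cauchy can be moved from [v] to other representations because the squared
    norms of [A_m v - A_n v] depend only on the state of [v], and are affine and continuous in it.
    Convergence at the extreme points alone does not obviously reach a given point of a compact
    convex set; Simons' inequality achieves this for functions whose countable convex combinations
    attain their maximum at extreme points. Countability of [G] locates the maxima there: it
    provides a continuous strictly convex function on the states. *)

Section ComplexSequences.
Variable R : realType.
Implicit Types (e : R).

Lemma posC_ex (e : R[i]) : 0 < e -> exists2 r : R, 0 < r & e = r%:C.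
Proof.
case: e => a b; rewrite ltcE /= => /andP[/eqP -> a0]; by exists a.
Qed.

(** Positive elements of [R[i]] are real, so tolerances may be taken in [R], where the order is
    total. *)
Lemma cvgC_P (V : normedModType R[i]) (x : nat -> V) (l : V) :
  x n @[n --> \oo] --> l <->
  forall e, 0 < e -> exists N, forall n, (N <= n)%N -> `|l - x n| < e%:C.
Proof.
split=> [/cvgrPdist_lt xl e e0|H].
  have /xl[N _ HN] : 0 < e%:C by rewrite ltcR.
  by exists N => n Nn; apply: HN.
apply/cvgrPdist_lt => _ /posC_ex[e e0 ->].
by have [N HN] := H _ e0; exists N.
Qed.

Lemma cauchyC_cvg (V : completeNormedModType R[i]) (x : nat -> V) :
  (forall e, 0 < e -> exists N, forall m n, (N <= m)%N -> (N <= n)%N ->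
    `|x m - x n| < e%:C) -> exists l : V, x n @[n --> \oo] --> l.
Proof.
move=> H.
have /cauchy_cvgP : cauchy (x @ \oo).
  apply/cauchy_exP => _ /posC_ex[e e0 ->].
  have [N HN] := H _ e0; exists (x N); exists N => // n Nn /=.
  by rewrite -ball_normE /=; apply: HN.
by move=> /cvg_ex.
Qed.

Lemma norm_i : `|'i%C : R[i]| = 1.
Proof. by apply/eqP; rewrite -(@pexpr_eq1 _ _ 2) // -normrX sqr_i normrN1. Qed.

Lemma normc_real (r : R) : `|r%:C| = `|r|%:C.
Proof. by rewrite normc_def [X in _ + X]mulr0 addr0 sqrtr_sqr. Qed.

Lemma normC_ReIm (z : R[i]) : `|z| <= (`|complex.Re z| + `|complex.Im z|)%:C.
Proof.
rewrite {1}[z]complexE; apply: le_trans (ler_normD _ _) _.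
rewrite normrM.
rewrite norm_i.
by rewrite mul1r !normc_real rmorphD.
Qed.

Lemma ler_ReC (z : R[i]) r : `|z| <= r%:C -> `|complex.Re z| <= r.
Proof. by move=> h; rewrite -lecR (le_trans (normc_ge_Re z)). Qed.

Lemma ler_ImC (z : R[i]) r : `|z| <= r%:C -> `|complex.Im z| <= r.
Proof.
move=> h; have := @ler_ReC (z * 'i) r; rewrite ReiNIm normrN; apply.
by rewrite normrM norm_i mulr1.
Qed.

Lemma cauchy_R (x : nat -> R) :
  (forall e, 0 < e -> exists N, forall m n, (N <= m)%N -> (N <= n)%N ->
    `|x m - x n| <= e) -> exists l : R, x n @[n --> \oo] --> l.
Proof.
move=> H.
have /cauchy_cvgP : cauchy (x @ \oo).
  apply/cauchy_exP => e e0.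
  have [|N HN] := H (e / 2); first by rewrite divr_gt0.
  exists (x N); exists N => // n Nn /=.
  rewrite -ball_normE /=; apply: le_lt_trans (HN _ _ _ _) _ => //.
  by rewrite ltr_pdivrMr// ltr_pMr// ltr1n.
by move=> /cvg_ex.
Qed.

Lemma inv_nat_small e : 0 < e ->
  exists N, forall n, (N <= n)%N -> n.+1%:R^-1 < e.
Proof.
move=> e0; have /cvgrPdist_lt/(_ _ e0)[N _ hN] := @cvg_harmonic R.
by exists N => n /hN; rewrite /= sub0r normrN gtr0_norm.
Qed.

Lemma cauchyC (z : nat -> R[i]) :
  (forall e, 0 < e -> exists N, forall m n, (N <= m)%N -> (N <= n)%N ->
    `|z m - z n| <= e%:C) -> exists l : R[i]^o, (z n : R[i]^o) @[n --> \oo] --> l.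
Proof.
move=> H.
have [|a ha] := @cauchy_R (fun n => complex.Re (z n)).
  move=> e /H[N HN]; exists N => m n Nm Nn.
  by rewrite -raddfB; apply: ler_ReC; apply: HN.
have [|b hb] := @cauchy_R (fun n => complex.Im (z n)).
  move=> e /H[N HN]; exists N => m n Nm Nn.
  by rewrite -raddfB; apply: ler_ImC; apply: HN.
exists (a +i* b); apply/(@cvgC_P R[i]^o) => e e0.
have e20 : 0 < e / 2 by rewrite divr_gt0.
move/cvgrPdist_lt : ha => /(_ _ e20)[N1 _ h1].
move/cvgrPdist_lt : hb => /(_ _ e20)[N2 _ h2].
exists (maxn N1 N2) => n; rewrite geq_max => /andP[/h1 {}h1 /h2 {}h2].
apply: le_lt_trans (normC_ReIm _) _; rewrite ltcR.
rewrite !raddfB /= (splitr e).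
exact: ltrD.
Qed.


Lemma cvgCD (z w : nat -> R[i]^o) (a b : R[i]^o) : z n @[n --> \oo] --> a ->
  w n @[n --> \oo] --> b -> (z n + w n : R[i]^o) @[n --> \oo] --> (a + b : R[i]^o).
Proof. exact: cvgD. Qed.
Lemma cvgCM (z w : nat -> R[i]^o) (a b : R[i]^o) : z n @[n --> \oo] --> a ->
  w n @[n --> \oo] --> b -> (z n * w n : R[i]^o) @[n --> \oo] --> (a * b : R[i]^o).
Proof. exact: cvgM. Qed.
Lemma cvgCJ (z : nat -> R[i]^o) (a : R[i]^o) : z n @[n --> \oo] --> a ->
  (Num.conj (z n) : R[i]^o) @[n --> \oo] --> (Num.conj a : R[i]^o).
Proof.
move=> /(@cvgC_P R[i]^o) h; apply/(@cvgC_P R[i]^o) => e /h[N hN].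
by exists N => n /hN; rewrite -rmorphB norm_conjC.
Qed.
Lemma cvgC_unique (z : nat -> R[i]^o) (a b : R[i]^o) : z n @[n --> \oo] --> a ->
  z n @[n --> \oo] --> b -> a = b.
Proof. move=> h1 h2. by rewrite -(cvg_lim _ h1) // -(cvg_lim _ h2). Qed.
Lemma conjC_real (r : R) : Num.conj r%:C = r%:C.
Proof. by rewrite conj_Creal // complex_real. Qed.

End ComplexSequences.

(** * Pre-Hilbert spaces *)

(** No vector space laws are asked of the carrier and the form may be degenerate. Lists of group
    algebra terms, added by concatenation, qualify as they stand; identities between vectors are
    tested through the form. *)
Record preHilbert (R : realType) := PreHilbert {
  ph_sort :> Type;
  ph0 : ph_sort;
  ph_add : ph_sort -> ph_sort -> ph_sort;
  ph_scale : R[i] -> ph_sort -> ph_sort;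
  ph_form : ph_sort -> ph_sort -> R[i];
  ph_form0 : forall x, ph_form ph0 x = 0;
  ph_formD : forall x y z, ph_form (ph_add x y) z = ph_form x z + ph_form y z;
  ph_formZ : forall a x y, ph_form (ph_scale a x) y = a * ph_form x y;
  ph_formC : forall x y, ph_form y x = Num.conj (ph_form x y);
  ph_form_ge0 : forall x, 0 <= ph_form x x
}.

Section PreHilbertTheory.
Variables (R : realType) (X : preHilbert R).
Implicit Types (x y z : X) (a : R[i]).
Local Notation B := (@ph_form R X).
Local Notation add := (@ph_add R X).
Local Notation scale := (@ph_scale R X).

Lemma ph_formDr x y z : B z (add x y) = B z x + B z y.
Proof. by rewrite ph_formC ph_formD rmorphD /= -!ph_formC. Qed.
Lemma ph_formZr a x y : B y (scale a x) = Num.conj a * B y x.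
Proof. by rewrite ph_formC ph_formZ rmorphM /= -ph_formC. Qed.

Definition ph_sub x y := add x (scale (-1) y).
Lemma ph_formB x y z : B (ph_sub x y) z = B x z - B y z.
Proof. by rewrite ph_formD ph_formZ mulN1r. Qed.
Lemma ph_formBr x y z : B z (ph_sub x y) = B z x - B z y.
Proof. by rewrite ph_formDr ph_formZr rmorphN1 mulN1r. Qed.

Definition ph_sq x : R := complex.Re (B x x).
Definition ph_norm x : R := Num.sqrt (ph_sq x).

Lemma ph_sqE x : B x x = (ph_sq x)%:C.
Proof. by rewrite RRe_real // ger0_real // ph_form_ge0. Qed.
Lemma ph_sq_ge0 x : 0 <= ph_sq x.
Proof. by rewrite -ler0c -ph_sqE ph_form_ge0. Qed.
Lemma ph_norm_ge0 x : 0 <= ph_norm x. Proof. exact: sqrtr_ge0. Qed.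
Lemma ph_norm_sqr x : ph_norm x ^+ 2 = ph_sq x.
Proof. by rewrite sqr_sqrtr // ph_sq_ge0. Qed.
Lemma ph_sq_scale a x :
  ph_sq (scale a x) = (complex.Re a ^+ 2 + complex.Im a ^+ 2) * ph_sq x.
Proof.
rewrite /ph_sq ph_formZ ph_formZr mulrA -normCK (ph_sqE x).
by rewrite -add_Re2_Im2 -rmorphM.
Qed.
Lemma ph_sqD x y : ph_sq (add x y) = ph_sq x + ph_sq y + 2 * complex.Re (B x y).
Proof.
rewrite /ph_sq ph_formD !ph_formDr (ph_formC x y) !raddfD /=.
case: (B x y) => u v /=; ring.
Qed.

(* With [d] the squared distance from [x] to the line spanned by [y] this is
   Pythagoras; [d = 0] is Cauchy-Schwarz. *)
Lemma ph_form_sqr_le (d : R) x y :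
  (forall a, d <= ph_sq (add x (scale a y))) ->
  `|B x y| ^+ 2 <= ((ph_sq x - d) * ph_sq y)%:C.
Proof.
move=> hd; rewrite -add_Re2_Im2 lecR.
set b := _ + _.
have b0 : 0 <= b by rewrite addr_ge0 ?sqr_ge0.
(* The test vectors [x - t (B x y) y] turn the hypothesis into a real quadratic inequality in
   [t]. *)
have H (t : R) : 0 <= (ph_sq x - d) - 2 * t * b + t ^+ 2 * b * ph_sq y.
  have := hd ((- t)%:C * B x y).
  rewrite ph_sqD ph_sq_scale ph_formZr.
  set w := (- t)%:C * B x y.
  have -> : complex.Re w ^+ 2 + complex.Im w ^+ 2 = t ^+ 2 * b.
    apply: complexI; rewrite add_Re2_Im2 normrM exprMn -!add_Re2_Im2.
    by rewrite -rmorphM /= [0 ^+ 2]mulr0 addr0 sqrrN.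
  have -> : Num.conj w * B x y = (- t * b)%:C.
    rewrite rmorphM /= conjC_real -mulrA [Num.conj _ * _]mulrC -normCK.
    by rewrite -add_Re2_Im2 -rmorphM.
  by rewrite -subr_ge0 => /= h; move: h; congr (_ <= _); ring.
have x0 : 0 <= ph_sq x - d by have := H 0; congr (_ <= _); ring.
have y0 := ph_sq_ge0 y.
move: x0 H; move: (ph_sq x - d) => A x0 H.
have [bp|] := ltP 0 b; last first.
  by move=> bn; apply: le_trans bn _; rewrite mulr_ge0.
have [yp|yn] := ltP 0 (ph_sq y).
  have := H (ph_sq y)^-1; rewrite expr2 => h.
  rewrite -ler_pdivrMr //; move: h.
  have -> : A - 2 / ph_sq y * b + (ph_sq y)^-1 / ph_sq y * b * ph_sq y =
    A - b / ph_sq y by field; rewrite gt_eqF.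
  by rewrite subr_ge0.
have yE : ph_sq y = 0 by apply/eqP; rewrite eq_le yn y0.
(* For [y] of norm 0 the quadratic is affine in [t]; this [t] makes it [- A - 2], which is
   negative. *)
have := H ((A + 1) / b).
rewrite yE mulr0 addr0.
have -> : 2 * ((A + 1) / b) * b = 2 * (A + 1).
  by field; rewrite gt_eqF.
lra.
Qed.

Lemma ph_CS x y : `|B x y| <= (ph_norm x * ph_norm y)%:C.
Proof.
rewrite -ler_sqr ?nnegrE //; last by rewrite ler0c mulr_ge0 // ph_norm_ge0.
rewrite -[leRHS](rmorphXn (real_complex R)) exprMn !ph_norm_sqr.
by rewrite -[ph_sq x]subr0; apply: ph_form_sqr_le => a; apply: ph_sq_ge0.
Qed.

Lemma ph_norm_le x (r : R) : 0 <= r -> (ph_norm x <= r) = (ph_sq x <= r ^+ 2).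
Proof. by move=> r0; rewrite -ph_norm_sqr ler_sqr // ?nnegrE ?ph_norm_ge0. Qed.

Lemma ph_normD x y : ph_norm (add x y) <= ph_norm x + ph_norm y.
Proof.
rewrite ph_norm_le ?addr_ge0 ?ph_norm_ge0 // ph_sqD sqrrD !ph_norm_sqr.
have := ler_ReC (ph_CS x y); rewrite ler_norml => /andP[_].
move: (ph_norm x * ph_norm y) => u; rewrite -mulr_natr; lra.
Qed.

Lemma ph_normZ a x : (ph_norm (scale a x))%:C = `|a| * (ph_norm x)%:C.
Proof.
have n0 y : 0 <= (ph_norm y)%:C by rewrite ler0c ph_norm_ge0.
apply/eqP; rewrite -(@eqrXn2 _ 2) //; last exact: mulr_ge0.
rewrite exprMn -[eqbLHS](rmorphXn (real_complex R)).
rewrite -[X in _ == _ * X](rmorphXn (real_complex R)).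
by rewrite !ph_norm_sqr ph_sq_scale -add_Re2_Im2 -rmorphM.
Qed.

(** Equal sums may be distinct elements of the carrier, as lists in different orders are; pairing
    equally with every vector is the substitute for equality. *)
Lemma ph_norm_ext x y : (forall z, B x z = B y z) -> ph_norm x = ph_norm y.
Proof.
by move=> h; rewrite /ph_norm /ph_sq h ph_formC h -ph_formC.
Qed.

Definition ph_cauchy (c : nat -> X) := forall e : R, 0 < e ->
  exists N, forall m n, (N <= m)%N -> (N <= n)%N -> ph_norm (ph_sub (c m) (c n)) <= e.

Lemma ph_cauchy_bound c : ph_cauchy c -> exists M : R,
  0 < M /\ exists N, forall n, (N <= n)%N -> ph_norm (c n) <= M.
Proof.
move=> /(_ 1 ltr01)[N hN]; exists (ph_norm (c N) + 1); split.
  by rewrite ltr_wpDl ?ph_norm_ge0.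
exists N => n Nn.
have -> : ph_norm (c n) = ph_norm (add (c N) (ph_sub (c n) (c N))).
  by apply: ph_norm_ext => z; rewrite ph_formD ph_formB addrC subrK.
by apply: le_trans (ph_normD _ _) _; rewrite lerD2l hN.
Qed.

Lemma ph_cauchy_cst x : ph_cauchy (fun _ => x).
Proof.
move=> e e0; exists 0 => m n _ _.
rewrite ph_norm_le ?ltW // /ph_sq ph_formB subrr.
exact: exprn_gt0.
Qed.

Lemma ph_cauchy_comb a c d : ph_cauchy c -> ph_cauchy d ->
  ph_cauchy (fun n => add (scale a (c n)) (d n)).
Proof.
move=> hc hd e e0.
have n0 : 0 < complex.Re `|a| + 1.
  by rewrite ltr_wpDl // -ler0c RRe_real ?normr_real.
have [|N1 h1] := hc (e / 2 / (complex.Re `|a| + 1)); first by rewrite !divr_gt0.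
have [|N2 h2] := hd (e / 2); first by rewrite divr_gt0.
exists (maxn N1 N2) => m n; rewrite !geq_max => /andP[m1 m2] /andP[k1 k2].
have -> : ph_norm (ph_sub (add (scale a (c m)) (d m)) (add (scale a (c n)) (d n)))
  = ph_norm (add (scale a (ph_sub (c m) (c n))) (ph_sub (d m) (d n))).
  apply: ph_norm_ext => z; rewrite !(ph_formD, ph_formB, ph_formZ); ring.
apply: le_trans (ph_normD _ _) _; rewrite (splitr e); apply: lerD; last exact: h2.
rewrite -lecR ph_normZ -(RRe_real (normr_real a)) -rmorphM lecR.
have h := h1 _ _ m1 k1.
have : (complex.Re `|a| + 1) * ph_norm (ph_sub (c m) (c n)) <= e / 2.
  by rewrite mulrC -ler_pdivlMr.
apply: le_trans; rewrite ler_wpM2r ?ph_norm_ge0 // lerDl //.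
Qed.

Lemma ph_form_cauchy c d : ph_cauchy c -> ph_cauchy d ->
  exists l : R[i]^o, (B (c n) (d n) : R[i]^o) @[n --> \oo] --> l.
Proof.
move=> hc hd; apply: cauchyC => e e0.
have [M [M0 [N1 hM]]] := ph_cauchy_bound hc.
have [M' [M'0 [N2 hM']]] := ph_cauchy_bound hd.
have [|N3 h3] := hc (e / 2 / M'); first by rewrite !divr_gt0.
have [|N4 h4] := hd (e / 2 / M); first by rewrite !divr_gt0.
exists (maxn (maxn N1 N2) (maxn N3 N4)) => m n; rewrite !geq_max.
move=> /andP[/andP[m1 m2] /andP[m3 m4]] /andP[/andP[n1 n2] /andP[n3 n4]].
have -> : B (c m) (d m) - B (c n) (d n) =
  B (ph_sub (c m) (c n)) (d m) + B (c n) (ph_sub (d m) (d n)).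
  by rewrite ph_formB ph_formBr addrA subrK.
apply: le_trans (ler_normD _ _) _; rewrite (splitr e) rmorphD; apply: lerD.
  apply: le_trans (ph_CS _ _) _; rewrite lecR.
  apply: le_trans (_ : e / 2 / M' * M' <= _); last by rewrite divfK ?gt_eqF.
  by apply: ler_pM; rewrite ?ph_norm_ge0 ?h3 ?hM'.
apply: le_trans (ph_CS _ _) _; rewrite lecR mulrC.
apply: le_trans (_ : e / 2 / M * M <= _); last by rewrite divfK ?gt_eqF.
by apply: ler_pM; rewrite ?ph_norm_ge0 ?h4 ?hM.
Qed.

End PreHilbertTheory.

(** * Completion of a pre-Hilbert space *)

Section Completion.
Variables (R : realType) (X : preHilbert R).
Local Notation B := (@ph_form R X).
Local Notation sub := (@ph_sub R X).

(* A point of the completion is the functional [lim_n B (c n)] defined by a Cauchy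
   sequence [c], so that no quotient is needed. *)
Definition completes (c : nat -> X) (f : X -> R[i]^o) :=
  ph_cauchy c /\ forall x, (B (c n) x : R[i]^o) @[n --> \oo] --> f x.

Definition completion_pred : {pred X -> R[i]^o} :=
  fun f => `[< exists c, completes c f >].

Lemma completes_comb a c d f g : completes c f -> completes d g ->
  completes (fun n => ph_add (ph_scale a (c n)) (d n)) (a *: f + g).
Proof.
move=> [hc fc] [hd gd]; split; first exact: ph_cauchy_comb.
move=> x.
have -> : (fun n => B (ph_add (ph_scale a (c n)) (d n)) x : R[i]^o) =
    (fun n => a * B (c n) x + B (d n) x).
  by apply/funext => n; rewrite ph_formD ph_formZ.
by apply: cvgCD => //; apply: cvgCM => //; apply: cvg_cst.
Qed.

Lemma completes0 : completes (fun _ => ph0 X) 0.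
Proof.
split; first exact: ph_cauchy_cst.
move=> x; under eq_fun do rewrite ph_form0; exact: cvg_cst.
Qed.

Lemma completion_submod : submod_closed completion_pred.
Proof.
split; first by apply/asboolP; exists (fun _ => ph0 X); apply: completes0.
move=> a f g /asboolP[c cf] /asboolP[d dg]; apply/asboolP.
by exists (fun n => ph_add (ph_scale a (c n)) (d n)); apply: completes_comb.
Qed.

HB.instance Definition _ := GRing.isSubmodClosed.Build _ _ completion_pred
  (completion_submod).

Record completion := Completion {
  completion_fun :> X -> R[i]^o;
  completionP : completion_fun \in completion_pred }.

HB.instance Definition _ := [isSub for completion_fun].
HB.instance Definition _ := [Choice of completion by <:].
HB.instance Definition _ := [SubChoice_isSubLmodule of completion by <:].

Lemma completion_rep (f : completion) : {c | completes c f}.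
Proof. by apply: cid; apply/asboolP/(completionP f). Qed.

Definition rep (f : completion) := projT1 (completion_rep f).
Lemma repP f : completes (rep f) f. Proof. exact: projT2 (completion_rep f). Qed.

(** Since [f (d n)] has the same limit as [B (c n) (d n)], that limit depends on [c] only through
    [f]. The independence of representatives rests on this. *)
Lemma completes_form_lim c d f g (l : R[i]^o) : completes c f -> completes d g ->
  (B (c n) (d n) : R[i]^o) @[n --> \oo] --> l -> f (d n) @[n --> \oo] --> l.
Proof.
move=> [hc fc] [hd gd] hl; apply/(@cvgC_P R R[i]^o) => e e0.
have [M [M0 [N1 hM]]] := ph_cauchy_bound hd.
have [|N2 h2] := hc (e / 4 / M); first by rewrite !divr_gt0.
have e40 : 0 < e / 4 by rewrite divr_gt0.
have e20 : 0 < e / 2 by rewrite divr_gt0.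
have [N3 h3] := (@cvgC_P R R[i]^o _ _).1 hl _ e40.
exists (maxn N1 (maxn N2 N3)) => n; rewrite !geq_max => /and3P[n1 n2 n3].
have [N4 h4] := (@cvgC_P R R[i]^o _ _).1 (fc (d n)) _ e20.
(* [N4] depends on [n], because [B (c m)] converges to [f] only pointwise; the Cauchy bound from
   [N2] is uniform in [m] and absorbs this. *)
pose m := maxn N2 N4.
have -> : l - f (d n) = (l - B (c n) (d n)) + (B (sub (c n) (c m)) (d n))
   - (f (d n) - B (c m) (d n)).
  by rewrite ph_formB; ring.
apply: le_lt_trans (ler_normB _ _) _.
have -> : e%:C = (e / 4)%:C + (e / 4)%:C + (e / 2)%:C.
  by rewrite -!rmorphD; congr (_%:C); field.
apply: ler_ltD; last by apply: h4; rewrite leq_maxr.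
apply: le_trans (ler_normD _ _) _; apply: lerD; first by apply/ltW/h3.
apply: le_trans (ph_CS _ _) _; rewrite lecR.
apply: le_trans (_ : e / 4 / M * M <= _); last by rewrite divfK ?gt_eqF.
apply: ler_pM; rewrite ?ph_norm_ge0 ?hM //.
by apply: h2 => //; rewrite leq_maxl.
Qed.

Lemma completion_form_exists : {F : completion -> completion -> R[i] |
  forall c d (f g : completion), completes c f -> completes d g ->
    (B (c n) (d n) : R[i]^o) @[n --> \oo] --> (F f g : R[i]^o)}.
Proof.
exists (fun f g => lim ((B (rep f n) (rep g n) : R[i]^o) @[n --> \oo])).
have repl c1 c2 d1 (f1 g1 : completion) (l : R[i]^o) :
    completes c1 f1 -> completes c2 f1 -> completes d1 g1 ->
    (B (c1 n) (d1 n) : R[i]^o) @[n --> \oo] --> l ->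
    (B (c2 n) (d1 n) : R[i]^o) @[n --> \oo] --> l.
  move=> h1 h2 h3 hl.
  have [l' hl'] := ph_form_cauchy h2.1 h3.1.
  have a1 := completes_form_lim h1 h3 hl.
  have a2 := completes_form_lim h2 h3 hl'.
  by rewrite (cvgC_unique a1 a2).
have sym (c1 d1 : nat -> X) (l : R[i]^o) :
    (B (c1 n) (d1 n) : R[i]^o) @[n --> \oo] --> l ->
    (B (d1 n) (c1 n) : R[i]^o) @[n --> \oo] --> (Num.conj l : R[i]^o).
  move=> /cvgCJ h.
  have -> : (fun n => B (d1 n) (c1 n) : R[i]^o) =
      (fun n => Num.conj (B (c1 n) (d1 n))).
    by apply/funext => n; rewrite -ph_formC.
  exact: h.
move=> c d f g hc hd; have rf := repP f; have rg := repP g.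
have [l hl] := ph_form_cauchy rf.1 rg.1.
rewrite (cvg_lim _ hl) //.
(* Representatives are exchanged one argument at a time, the second one by conjugate symmetry. *)
have h := repl _ _ _ _ _ _ rf hc rg hl.
have h' := repl _ _ _ _ _ _ rg hd hc (sym _ _ _ h).
by rewrite -[l]conjCK; apply: sym h'.
Qed.

(* Extracted from an opaque lemma: conversion diverges when it can unfold the
   limit of chosen representatives. *)
Definition completion_form := projT1 completion_form_exists.

Lemma completion_formE c d (f g : completion) : completes c f -> completes d g ->
  (B (c n) (d n) : R[i]^o) @[n --> \oo] --> (completion_form f g : R[i]^o).
Proof. exact: (projT2 completion_form_exists). Qed.


Lemma completion_form_lim (f g : completion) :
  (B (rep f n) (rep g n) : R[i]^o) @[n --> \oo] --> (completion_form f g : R[i]^o).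
Proof. by apply: completion_formE; apply: repP. Qed.

Lemma completion_formZD a (f g h : completion) :
  completion_form (a *: f + g) h = a * completion_form f h + completion_form g h.
Proof.
have rf := repP f; have rg := repP g; have rh := repP h.
have hc : completes (fun n => ph_add (ph_scale a (rep f n)) (rep g n))
    (a *: f + g : completion).
  have -> : completion_fun (a *: f + g) = a *: completion_fun f + completion_fun g.
    by [].
  exact: (completes_comb a rf rg).
refine (cvgC_unique (completion_formE hc rh) _).
under eq_fun do rewrite ph_formD ph_formZ.
apply: cvgCD; last exact: completion_form_lim.
by apply: cvgCM; [exact: cvg_cst|exact: completion_form_lim].
Qed.

Lemma completion_form0 (f : completion) : completion_form 0 f = 0.
Proof.
have := completion_formZD (-1) 0 0 f.
by rewrite scaler0 addr0 mulN1r addNr.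
Qed.

Lemma completion_formD (f g h : completion) :
  completion_form (f + g) h = completion_form f h + completion_form g h.
Proof. by have := completion_formZD 1 f g h; rewrite scale1r mul1r. Qed.

Lemma completion_formZ a (f g : completion) :
  completion_form (a *: f) g = a * completion_form f g.
Proof.
by have := completion_formZD a f 0 g; rewrite addr0 completion_form0 addr0.
Qed.

Lemma completion_formC (f g : completion) :
  completion_form g f = Num.conj (completion_form f g).
Proof.
refine (cvgC_unique (@completion_form_lim g f) _).
under eq_fun do rewrite ph_formC.
by apply: cvgCJ; exact: completion_form_lim.
Qed.

Lemma completion_form_ge0 (f : completion) : 0 <= completion_form f f.
Proof.
have h := @completion_form_lim f f.
suff -> : completion_form f f = `|completion_form f f| by rewrite normr_ge0.
refine (cvgC_unique h _).
apply/(@cvgC_P R R[i]^o) => e /((@cvgC_P R R[i]^o _ _).1 h)[N hN].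
exists N => n /hN; apply: le_lt_trans.
by rewrite -[X in _ - X]ger0_norm ?ph_form_ge0 // ler_dist_dist.
Qed.

Definition completion_preHilbert := PreHilbert completion_form0 completion_formD
  completion_formZ completion_formC completion_form_ge0.

Definition embed_fun (x : X) : X -> R[i]^o := fun y => B x y.
Lemma completes_embed_fun x : completes (fun _ => x) (embed_fun x).
Proof. by split; [exact: ph_cauchy_cst|move=> y; exact: cvg_cst]. Qed.
Lemma embed_subproof x : embed_fun x \in completion_pred.
Proof. by apply/asboolP; exists (fun _ => x); apply: completes_embed_fun. Qed.
Definition embed x := Completion (embed_subproof x).
Lemma completes_embed x : completes (fun _ => x) (embed x).
Proof. exact: completes_embed_fun. Qed.

(** Reproducing identity. It turns norm 0 into the zero functional, and orthogonality to all
    embedded vectors into vanishing. *)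
Lemma completion_form_embed (f : completion) x : completion_form f (embed x) = f x.
Proof.
refine (cvgC_unique (completion_formE (repP f) (completes_embed x)) _).
exact: (repP f).2.
Qed.

Definition completion_norm (f : completion) : R[i] :=
  (@ph_norm R completion_preHilbert f)%:C.

Lemma completion_norm_sqr (f : completion) :
  completion_norm f ^+ 2 = completion_form f f.
Proof.
rewrite /completion_norm -[LHS](rmorphXn (real_complex R)) ph_norm_sqr.
exact/esym/(@ph_sqE R completion_preHilbert).
Qed.

Lemma completion_normD (f g : completion) :
  completion_norm (f + g) <= completion_norm f + completion_norm g.
Proof.
by rewrite /completion_norm -rmorphD lecR; exact: (@ph_normD R completion_preHilbert).
Qed.

Lemma completion_normZ a (f : completion) :
  completion_norm (a *: f) = `|a| * completion_norm f.
Proof. exact: (@ph_normZ R completion_preHilbert). Qed.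

Lemma completion_norm0_eq0 (f : completion) : completion_norm f = 0 -> f = 0.
Proof.
move=> /complexI f0; apply/val_inj/funext => x /=.
rewrite -completion_form_embed; apply/eqP; rewrite -normr_le0.
apply: le_trans (@ph_CS R completion_preHilbert f (embed x)) _.
by rewrite f0 mul0r.
Qed.

HB.instance Definition _ := Lmodule_isNormed.Build R[i] completion
  completion_normD completion_normZ completion_norm0_eq0.


Lemma completion_normE (f : completion) : `|f| = completion_norm f.
Proof. by []. Qed.

Lemma completes_norm_lim c d (f g : completion) (r : R) :
  completes c f -> completes d g ->
  (exists N, forall n, (N <= n)%N -> ph_norm (sub (c n) (d n)) <= r) ->
  `|f - g| <= r%:C.
Proof.
move=> hc hd [N hN]; rewrite completion_normE.
have r0 : 0 <= r by apply: le_trans (hN N _); rewrite ?ph_norm_ge0.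
rewrite lecR ph_norm_le //.
have h : completes (fun n => sub (c n) (d n)) (f - g : completion).
  have -> : completion_fun (f - g) = (-1) *: completion_fun g + completion_fun f.
    by rewrite scaleN1r addrC.
  have [h1 h2] := completes_comb (-1) hd hc; split.
    move=> e /(h1 _)[M hM]; exists M => m n Mm Mn.
    apply: le_trans (hM m n Mm Mn); rewrite le_eqVlt; apply/orP; left; apply/eqP.
    by apply: ph_norm_ext => z; rewrite !(ph_formD,ph_formB,ph_formZ); ring.
  move=> x.
  have -> : (fun n => B (sub (c n) (d n)) x : R[i]^o) =
      (fun n => B (ph_add (ph_scale (-1) (d n)) (c n)) x).
    by apply/funext => n; rewrite !(ph_formD,ph_formB,ph_formZ); ring.
  exact: h2.
have hl := completion_formE h h.
apply/ler_addgt0Pr => e e0.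
have [M hM] := (@cvgC_P R R[i]^o _ _).1 hl _ e0.
have := hM (maxn N M) (leq_maxr _ _).
set n := maxn N M.
move=> /ltW/ler_ReC; rewrite raddfB /= ler_norml => /andP[_].
rewrite lerBlDr => /le_trans; apply; rewrite addrC lerD2r.
rewrite -[complex.Re _]/(ph_sq _) -ph_norm_sqr ler_sqr ?nnegrE ?ph_norm_ge0 //.
by apply: hN; rewrite leq_maxl.
Qed.

Lemma embed_dense (f : completion) (r : R) : 0 < r ->
  exists x, `|f - embed x| <= r%:C.
Proof.
move=> r0; have h := repP f; have [N hN] := h.1 _ r0.
exists (rep f N); apply: (completes_norm_lim h (completes_embed _)).
by exists N => n Nn; apply: hN.
Qed.

Lemma embed_dist x y : `|embed x - embed y| = (ph_norm (sub x y))%:C.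
Proof.
apply/eqP; rewrite -(@eqrXn2 _ 2) // ?ler0c ?ph_norm_ge0 //.
rewrite completion_normE completion_norm_sqr.
rewrite -[X in _ == X](rmorphXn (real_complex R)) ph_norm_sqr.
rewrite -[X in _ == X]/((ph_sq (sub x y))%:C) -ph_sqE.
have -> : embed x - embed y = embed (sub x y).
  by apply/val_inj/funext => z /=; rewrite /embed_fun ph_formB.
by rewrite completion_form_embed.
Qed.

(** A Cauchy filter has points [h n] of accuracy [1/(n+1)]. By density they are replaced with
    embedded vectors [x n], and the sequence [x] is directly a representative of the limit. *)
Lemma completion_complete (F : set_system completion) :
  ProperFilter F -> cauchy F -> cvg F.
Proof.
move=> FF /cauchyP hF.
pose e n : R := n.+1%:R^-1.
have e0 n : 0 < e n by rewrite invr_gt0 ltr0n.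
have e_small (r : R) : 0 < r -> exists N, forall n, (N <= n)%N -> e n < r.
  exact: inv_nat_small.
have /choice[h hh] n : exists h, F (ball h (e n)%:C).
  by apply: hF; rewrite ltcR.
have /choice[x hx] n : exists x, `|h n - embed x| <= (e n)%:C by apply: embed_dense.
have near_h m n : `|h m - h n| <= (e m + e n)%:C.
  have [f [hm hn]] := filter_ex (filterI (hh m) (hh n)).
  move: hm hn; rewrite -!ball_normE /= => hm hn.
  rewrite -[h m](subrK f) -addrA; apply: le_trans (ler_normD _ _) _.
  rewrite rmorphD; apply: lerD; first exact: ltW hm.
  by rewrite distrC; exact: ltW hn.
have hc : ph_cauchy x.
  move=> r r0; have [|N hN] := e_small (r / 4); first by rewrite divr_gt0.
  exists N => m n Nm Nn; rewrite -lecR -embed_dist.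
  have -> : embed (x m) - embed (x n) =
    - (h m - embed (x m)) + (h m - h n) + (h n - embed (x n)).
    by rewrite opprB !addrA subrK subrK.
  apply: le_trans (ler_normD _ _) _.
  apply: le_trans (_ : (e m + (e m + e n) + e n)%:C <= _); last first.
    by rewrite lecR; have := hN _ Nm; have := hN _ Nn; lra.
  rewrite rmorphD lerD //; apply: le_trans (ler_normD _ _) _.
  by rewrite rmorphD lerD // normrN.
have /choice[f hf] y : exists l : R[i]^o, (B (x n) y : R[i]^o) @[n --> \oo] --> l.
  by apply: ph_form_cauchy => //; apply: ph_cauchy_cst.
have fP : f \in completion_pred by apply/asboolP; exists x.
have hcf : completes x (Completion fP) by [].
apply/cvg_ex; exists (Completion fP); apply/cvg_ballP => _ /posC_ex[r r0 ->].
have r4 : 0 < r / 4 by rewrite divr_gt0.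
have [N1 hN1] := e_small _ r4.
have [N2 hN2] := hc _ r4.
pose n := maxn N1 N2.
have en : e n < r / 4 by apply: hN1; rewrite leq_maxl.
apply: filterS (hh n) => g; rewrite -!ball_normE /= => hg.
have -> : Completion fP - g =
  (Completion fP - embed (x n)) - (h n - embed (x n)) + (h n - g).
  by rewrite opprB !addrA !subrK.
apply: le_lt_trans (ler_normD _ _) _.
apply: lt_trans (_ : ((r / 4 + e n) + e n)%:C < _); last first.
  by rewrite ltcR; lra.
rewrite rmorphD; apply: ler_ltD; last exact: hg.
apply: le_trans (ler_normD _ _) _.
rewrite rmorphD; apply: lerD; last by rewrite normrN; exact: hx.
apply: (completes_norm_lim hcf (completes_embed _)).
by exists N2 => m Nm; apply: hN2; rewrite ?leq_maxr.
Qed.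

HB.instance Definition _ := Uniform_isComplete.Build completion completion_complete.

Lemma completion_formZDr a (f g h : completion) :
  completion_form f (a *: g + h) =
  Num.conj a * completion_form f g + completion_form f h.
Proof.
rewrite completion_formC completion_formZD rmorphD rmorphM /=.
by rewrite -(completion_formC g f) -(completion_formC h f).
Qed.

Lemma completion_bilinear :
  @bilinear_for R[i] completion completion R[i] *%R (Num.conj \; *%R) completion_form.
Proof.
split=> [g a f h|f a g h]; first exact: completion_formZD.
exact: completion_formZDr.
Qed.
HB.instance Definition _ := bilinear_isBilinear.Build R[i] completion completion R[i]
  *%R (Num.conj \; *%R) completion_form completion_bilinear.

Lemma completion_hermitian (f g : completion) :
  completion_form f g = (-1) ^+ false * Num.conj (completion_form g f).
Proof. by rewrite mul1r completion_formC. Qed.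
HB.instance Definition _ := isHermitianSesquilinear.Build R[i] completion false Num.conj
  completion_form completion_hermitian.

Lemma completion_form_gt0 (f : completion) : f != 0 -> 0 < completion_form f f.
Proof.
move=> f0; rewrite -completion_norm_sqr -completion_normE exprn_gt0 //.
by rewrite normr_gt0.
Qed.
HB.instance Definition _ := isDotProduct.Build R[i] completion completion_form
  completion_form_gt0.

Definition completion_hilbert : hilbertType R :=
  @Hilbert R completion completion_form completion_norm_sqr.

End Completion.

(** * Projections in Hilbert spaces *)

Section HilbertTheory.
Variables (R : realType) (H : hilbertType R).
Local Notation B := (hdot H).
Implicit Types (x y z : H).

Lemma hdotDl x y z : B (x + y) z = B x z + B y z.
Proof. by rewrite linearDl. Qed.
Lemma hdotZl a x y : B (a *: x) y = a * B x y.
Proof. by rewrite linearZl_LR. Qed.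
Lemma hdotC x y : B y x = Num.conj (B x y).
Proof. by rewrite hermC mul1r. Qed.
Lemma hdot0l x : B 0 x = 0. Proof. by rewrite linear0l. Qed.
Lemma hdot_ge0 x : 0 <= B x x.
Proof. exact: dnorm_ge0. Qed.

Lemma Re_conj (z : R[i]) : complex.Re (Num.conj z) = complex.Re z.
Proof. by case: z. Qed.

Definition hilbert_preHilbert : preHilbert R :=
  PreHilbert hdot0l hdotDl hdotZl hdotC hdot_ge0.

Definition hsq x : R := @ph_sq R hilbert_preHilbert x.
Definition hnorm x : R := @ph_norm R hilbert_preHilbert x.

Lemma hnormE x : `|x| = (hnorm x)%:C.
Proof.
apply/eqP; rewrite -(@eqrXn2 _ 2) ?ler0c ?ph_norm_ge0 //.
rewrite hilbert_normE -[X in _ == X](rmorphXn (real_complex R)) ph_norm_sqr.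
by rewrite -[X in _ == X]/((ph_sq (x : hilbert_preHilbert))%:C) -ph_sqE.
Qed.
Lemma hsqE x : B x x = (hsq x)%:C. Proof. exact: (@ph_sqE R hilbert_preHilbert). Qed.
Lemma hnorm_sqr x : hnorm x ^+ 2 = hsq x. Proof. exact: ph_norm_sqr. Qed.
Lemma hnorm_ge0 x : 0 <= hnorm x. Proof. exact: ph_norm_ge0. Qed.
Lemma hsq_ge0 x : 0 <= hsq x. Proof. exact: ph_sq_ge0. Qed.
Lemma hdot_CS x y : `|B x y| <= `|x| * `|y|.
Proof. by rewrite !hnormE -rmorphM; exact: (@ph_CS R hilbert_preHilbert). Qed.
Lemma hsqZ a x : hsq (a *: x) = (complex.Re a ^+ 2 + complex.Im a ^+ 2) * hsq x.
Proof. exact: (@ph_sq_scale R hilbert_preHilbert). Qed.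
Lemma hsqD x y : hsq (x + y) = hsq x + hsq y + 2 * complex.Re (B x y).
Proof. exact: (@ph_sqD R hilbert_preHilbert). Qed.
Lemma hsqN x : hsq (- x) = hsq x.
Proof. by rewrite /hsq /ph_sq /= linearNl linearNr opprK. Qed.
Lemma hsqB x y : hsq (x - y) = hsq x + hsq y - 2 * complex.Re (B x y).
Proof. by rewrite hsqD hsqN /= linearNr raddfN mulrN. Qed.
Lemma hsq_eq0 x : hsq x = 0 -> x = 0.
Proof. by move=> h; apply/eqP; rewrite -(dnorm_eq0 (hdot H)) hsqE h. Qed.

Lemma hdotDr x y z : B z (x + y) = B z x + B z y.
Proof. by rewrite linearDr. Qed.
Lemma hdotBl x y z : B (x - y) z = B x z - B y z.
Proof. by rewrite linearBl. Qed.
Lemma hdotBr x y z : B z (x - y) = B z x - B z y.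
Proof. by rewrite linearBr. Qed.
Lemma hdotZr a x y : B y (a *: x) = Num.conj a * B y x.
Proof. by rewrite linearZr_LR. Qed.
Lemma hdot0r x : B x 0 = 0. Proof. by rewrite linear0r. Qed.
Lemma hdot_suml I (s : seq I) (F : I -> H) x :
  B (\sum_(i <- s) F i) x = \sum_(i <- s) B (F i) x.
Proof. by elim/big_rec2: _ => [|i u v _ <-]; rewrite ?hdot0l ?hdotDl. Qed.
Lemma hdot_ext x y : (forall z, B x z = B y z) -> x = y.
Proof.
move=> h; apply/eqP; rewrite -subr_eq0; apply/eqP/hsq_eq0/complexI.
by rewrite -hsqE hdotBl h subrr.
Qed.

Lemma cvg_hdotl (u : nat -> H) x y : u n @[n --> \oo] --> x ->
  (B (u n) y : R[i]^o) @[n --> \oo] --> (B x y : R[i]^o).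
Proof.
move=> /cvgC_P hu; apply/(@cvgC_P R R[i]^o) => e e0.
have y1 : 0 < hnorm y + 1 by rewrite ltr_wpDl ?hnorm_ge0.
have [|N hN] := hu (e / (hnorm y + 1)); first by rewrite divr_gt0.
exists N => n /hN; rewrite hnormE ltcR ltr_pdivlMr // => h.
rewrite -hdotBl; apply: le_lt_trans (hdot_CS _ _) _.
rewrite !hnormE -rmorphM ltcR; apply: le_lt_trans h.
by rewrite ler_wpM2l ?hnorm_ge0 // lerDl.
Qed.

Section Projection.
Variables (K : set H) (K_closed : closed K) (K_sub : linear_subspace K).

Lemma subspace_comb a x y : K x -> K y -> K (a *: x + y).
Proof.
move=> Kx Ky; have [_ h] := K_sub.
by have := h a x y; rewrite !inE; apply.
Qed.
Lemma subspace0 : K 0.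
Proof. by have [h _] := K_sub; move: h; rewrite inE. Qed.
Lemma subspaceD x y : K x -> K y -> K (x + y).
Proof. by move=> Kx Ky; rewrite -[x]scale1r; apply: subspace_comb. Qed.
Lemma subspaceZ a x : K x -> K (a *: x).
Proof.
move=> Kx; rewrite -[_ *: _]addr0; apply: subspace_comb => //.
exact: subspace0.
Qed.

(** A minimizing sequence [k] is Cauchy by the parallelogram law. Orthogonality is obtained along
    the sequence: by [ph_form_sqr_le] with [d = inf E], the squared pairing of [v - k n] with [w] is
    at most [(hsq (v - k n) - inf E) * hsq w], which tends to 0. *)
Lemma projection_exists v : exists p, K p /\ forall w, K w -> B (v - p) w = 0.
Proof.
pose E := [set hsq (v - k) | k in K].
have E0 : has_inf E.
  split; first by exists (hsq (v - 0)), 0 => //; apply: subspace0.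
  by exists 0 => _ [k _ <-]; apply: hsq_ge0.
have dE k : K k -> inf E <= hsq (v - k).
  by move=> Kk; apply: ge_inf; [exact: E0.2|exists k].
pose e n : R := n.+1%:R^-1.
have e0 n : 0 < e n by rewrite invr_gt0 ltr0n.
have e_small (r : R) : 0 < r -> exists N, forall n, (N <= n)%N -> e n < r.
  exact: inv_nat_small.
have /choice[k hk] n : exists k, K k /\ hsq (v - k) < inf E + e n.
  by have [_ [k Kk <-] h] := inf_adherent (e0 n) E0; exists k.
have par m n : hsq (k m - k n) <= 2 * (e m + e n).
  have -> : hsq (k m - k n) = 2 * hsq (v - k m) + 2 * hsq (v - k n) -
      4 * hsq (v - 2^-1 *: (k m + k n)).
    have -> : 4 * hsq (v - 2^-1 *: (k m + k n)) = hsq ((v - k m) + (v - k n)).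
      have -> : (v - k m) + (v - k n) = 2%:R *: (v - 2^-1 *: (k m + k n)).
        rewrite scalerBr scalerA divff ?pnatr_eq0 // scale1r scaler_nat mulr2n.
        by rewrite opprD addrACA.
      by rewrite [in RHS]hsqZ /=; ring.
    have -> : k m - k n = (v - k n) - (v - k m).
      by rewrite opprB [RHS]addrC addrA subrK.
    rewrite hsqB [hsq (_ + (v - k n))]hsqD [B (v - k n) _]hdotC.
    by rewrite Re_conj; ring.
  have h := dE (2^-1 *: (k m + k n)).
  have /h : K (2^-1 *: (k m + k n)).
    by apply: subspaceZ; apply: subspaceD; [exact: (hk m).1|exact: (hk n).1].
  have := (hk m).2; have := (hk n).2; lra.
have [p kp] : exists p : H, k n @[n --> \oo] --> p.
  apply: cauchyC_cvg => r r0.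
  have [|N hN] := e_small (r ^+ 2 / 4); first by rewrite divr_gt0 ?exprn_gt0.
  exists N => m n Nm Nn; rewrite hnormE ltcR.
  rewrite -ltr_sqr ?nnegrE ?hnorm_ge0 ?ltW // hnorm_sqr.
  apply: le_lt_trans (par m n) _.
  have := hN _ Nm; have := hN _ Nn; lra.
exists p; split.
  apply: (closed_cvg (fun x => K x)) kp => //.
  by apply: nearW => n; exact: (hk n).1.
move=> w Kw; apply: (@cvgC_unique R (fun n => B (v - k n) w)).
  apply: cvg_hdotl; apply/cvgC_P => r r0.
  have [N hN] := (cvgC_P _ _).1 kp _ r0.
  exists N => n /hN.
  have -> : (v - p) - (v - k n) = - (p - k n).
    by rewrite !opprB addrC addrA subrK.
  by rewrite normrN.
apply/(@cvgC_P R R[i]^o) => r r0.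
have w1 : 0 < hsq w + 1 by rewrite ltr_wpDl ?hsq_ge0.
have [|N hN] := e_small (r ^+ 2 / (hsq w + 1)).
  by rewrite divr_gt0 ?exprn_gt0.
exists N => n /hN; rewrite ltr_pdivlMr // => h.
rewrite sub0r normrN -ltr_sqr ?nnegrE //; last by rewrite ler0c ltW.
apply: le_lt_trans.
  apply: (@ph_form_sqr_le R hilbert_preHilbert (inf E) (v - k n) w) => a.
  rewrite -[ph_sq _]/(hsq (v - k n + a *: w)) -addrA -[- k n + _]opprK opprD opprK.
  by apply: dE; rewrite -scaleNr addrC; apply: subspace_comb => //; exact: (hk n).1.
rewrite -[X in _ < X](rmorphXn (real_complex R)) ltcR.
apply: le_lt_trans h; rewrite -![ph_sq _]/(hsq _).
apply: ler_pM; rewrite ?hsq_ge0 ?subr_ge0 ?dE ?lerDl //; first exact: (hk n).1.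
by have := (hk n).2; lra.
Qed.

End Projection.

Lemma orthproj_eq (K : set H) v p : linear_subspace K -> K p ->
  (forall w, K w -> B (v - p) w = 0) -> orthproj K v = p.
Proof.
move=> K_sub Kp pP; have hp : orthproj_spec K v p by [].
rewrite /orthproj; case: xgetP => [q _ [Kq qP]|/(_ p)//].
have Kd : K (q - p) by rewrite addrC -scaleN1r; apply: subspace_comb.
apply/eqP; rewrite -subr_eq0; apply/eqP/hsq_eq0/complexI; rewrite -hsqE.
have -> : B (q - p) (q - p) = B (v - p) (q - p) - B (v - q) (q - p).
  rewrite -hdotBl; congr (B _ _).
  by rewrite opprB [RHS]addrC addrA subrK.
by rewrite pP // qP // subr0.
Qed.

End HilbertTheory.

(** * Averages along Folner sequences *)

Section FiniteDim.
Variables (R : realType) (H : hilbertType R).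
Local Notation B := (hdot H).

(** The bijection in [finite_dimensional] is purely algebraic, with no continuity. The Gram matrix
    of the basis [b] is invertible, since a vector orthogonal to a basis is 0, and its inverse
    yields the dual basis [c]. Coordinates become inner products, so weak convergence implies norm
    convergence. *)
Lemma finite_dim_coordinates : finite_dimensional H ->
  exists n (b c : 'I_n -> H), forall u, u = \sum_j B u (b j) *: c j.
Proof.
move=> [n [f [g gf fg]]]; pose b i := g (delta_mx 0 i).
have ub u : u = \sum_i f u 0 i *: b i.
  apply: (can_inj gf); rewrite {1}[f u]row_sum_delta raddf_sum /=.
  by apply: eq_bigr => i _; rewrite linearZ /= fg.
pose M : 'M[R[i]]_n := \matrix_(i, j) B (b i) (b j).
have rM u : f u *m M = \row_j B u (b j).
  apply/rowP => j; rewrite !mxE {2}[u]ub hdot_suml.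
  by apply: eq_bigr => i _; rewrite mxE hdotZl.
have Mu : M \in unitmx.
  rewrite -row_free_unit -kermx_eq0; apply/rowV0P => x /sub_kermxP xM.
  rewrite -[x]fg; suff -> : g x = 0 by rewrite linear0.
  apply: hdot_ext => z; rewrite hdot0l hdotC {1}[z]ub hdot_suml.
  rewrite big1 ?conjC0 // => i _; rewrite hdotZl hdotC.
  have /rowP/(_ i) := rM (g x); rewrite fg xM !mxE => <-.
  by rewrite conjC0 mulr0.
exists n, b, (fun j => \sum_i invmx M j i *: b i) => u.
under eq_bigr do rewrite scaler_sumr.
rewrite exchange_big /= {1}[u]ub; apply: eq_bigr => i _.
under eq_bigr do rewrite scalerA.
rewrite -scaler_suml; congr (_ *: _).
rewrite -{1}[f u](mulmxK Mu) rM !mxE.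
by apply: eq_bigr => j _; rewrite mxE.
Qed.

Lemma finite_dim_weak_cvg (u : nat -> H) : finite_dimensional H ->
  (forall y, exists l : R[i]^o, (B (u n) y : R[i]^o) @[n --> \oo] --> l) ->
  exists l : H, u n @[n --> \oo] --> l.
Proof.
move=> /finite_dim_coordinates[n [b [c ubc]]] hu.
have /choice[l hl] j : exists l : R[i]^o, (B (u n) (b j) : R[i]^o) @[n --> \oo] --> l.
  exact: hu.
exists (\sum_j l j *: c j).
have -> : u = (fun k => \sum_j B (u k) (b j) *: c j) by apply/funext => k; exact: ubc.
elim: (index_enum _) => [|j s IH].
  rewrite big_nil; under eq_fun do rewrite big_nil; exact: cvg_cst.
rewrite big_cons; under eq_fun do rewrite big_cons.
by apply: cvgD => //; apply: cvgZr_tmp; exact: hl.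
Qed.
End FiniteDim.

(** * Averages, their adjoints, and the mean ergodic theorem *)

Section Averages.
Variables (R : realType) (G : groupType) (H : hilbertType R).
Implicit Types (A D : {fset G}) (f : G -> H).

Lemma sumr_const_fset (V : zmodType) A (x : V) : \sum_(s <- A) x = x *+ #|` A|.
Proof. by rewrite big_const_seq count_predT iter_addr_0. Qed.

Lemma norm_sum_fset A f (M : R) : (forall s, `|f s| <= M%:C) ->
  `|\sum_(s <- A) f s| <= (#|` A|%:R * M)%:C.
Proof.
move=> hf; apply: le_trans (ler_norm_sum _ _ _) _.
apply: le_trans (ler_sum _ (fun s _ => hf s)) _.
by rewrite sumr_const_fset mulr_natl rmorphMn.
Qed.

Lemma norm_sum_symdiff A D f (M : R) : (forall s, `|f s| <= M%:C) ->
  `|\sum_(s <- A) f s - \sum_(s <- D) f s| <= (#|` symdiff A D|%:R * M)%:C.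
Proof.
move=> hf.
rewrite (big_fsetID _ (mem D) A) (big_fsetID _ (mem A) D) /=.
have -> : [fset x in A | x \in D]%fset = (A `&` D)%fset.
  by apply/fsetP => x; rewrite !inE.
have -> : [fset x in D | x \in A]%fset = (A `&` D)%fset.
  by apply/fsetP => x; rewrite !inE andbC.
have -> : [fset x in A | x \notin D]%fset = (A `\` D)%fset.
  by apply/fsetP => x; rewrite !inE andbC.
have -> : [fset x in D | x \notin A]%fset = (D `\` A)%fset.
  by apply/fsetP => x; rewrite !inE andbC.
rewrite opprD addrACA subrr add0r.
apply: le_trans (ler_normB _ _) _.
have -> : #|` symdiff A D| = (#|` (A `\` D)%fset| + #|` (D `\` A)%fset|)%N.
  rewrite /symdiff -cardfsUI.
  have -> : ((A `\` D) `&` (D `\` A))%fset = fset0.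
    by apply/fsetP => x; rewrite !inE; case: (x \in A); case: (x \in D).
  by rewrite cardfs0 addn0.
rewrite natrD mulrDl rmorphD; apply: lerD; exact: norm_sum_fset.
Qed.

Lemma sum_left_translate A t f :
  \sum_(s <- left_translate t A) f s = \sum_(s <- A) f (t * s)%g.
Proof. by rewrite big_imfset //= => x y _ _ /mulgI. Qed.

Variable (pi : unitary_rep G H).
Local Notation B := (hdot H).

Lemma rep_hdot g x y : B (pi g x) (pi g y) = B x y.
Proof. by have [_ h] := rep_unitary pi g. Qed.
Lemma rep_hsq g x : hsq (pi g x) = hsq x.
Proof. by apply/complexI; rewrite -!hsqE rep_hdot. Qed.
Lemma rep_norm g x : `|pi g x| = `|x|.
Proof. by rewrite !hnormE /hnorm /ph_norm -/(hsq _) rep_hsq. Qed.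
Lemma rep_adjoint g x y : B (pi g x) y = B x (pi g^-1%g y).
Proof. by rewrite -(rep_hdot g^-1%g) -repM mulVg rep1. Qed.

Definition rep_coaverage A (v : H) : H :=
  (#|` A|%:R : R[i])^-1 *: \sum_(s <- A) pi s^-1%g v.

Lemma rep_average_adjoint A x y : B (rep_average pi A x) y = B x (rep_coaverage A y).
Proof.
rewrite hdotZl hdotZr hdot_suml (hdotC _ x) hdot_suml rmorph_sum /=.
rewrite fmorphV rmorph_nat; congr (_ * _); apply: eq_bigr => s _.
by rewrite rep_adjoint hdotC.
Qed.

Lemma card_inv_real A : `|(#|` A|%:R : R[i])^-1| = (#|` A|%:R^-1)%:C.
Proof. by rewrite normfV normr_nat fmorphV rmorph_nat. Qed.

Lemma rep_coaverage_norm A x : `|rep_coaverage A x| <= `|x|.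
Proof.
rewrite normrZ card_inv_real hnormE.
have [->|A0] := eqVneq #|` A| 0%N.
  by rewrite invr0 mul0r -hnormE normr_ge0.
have h : `|\sum_(s <- A) pi s^-1%g x| <= (#|` A|%:R * hnorm x)%:C.
  by apply: norm_sum_fset => s; rewrite rep_norm hnormE.
apply: le_trans (ler_wpM2l _ h) _.
  by rewrite ler0c invr_ge0 ler0n.
by rewrite -rmorphM mulrA mulVf ?pnatr_eq0 // mul1r lexx.
Qed.

Lemma rep_coaverage_comb A a x y :
  rep_coaverage A (a *: x + y) = a *: rep_coaverage A x + rep_coaverage A y.
Proof.
rewrite /rep_coaverage scalerA mulrC -scalerA -scalerDr; congr (_ *: _).
by rewrite scaler_sumr -big_split; apply: eq_bigr => s _; rewrite linearP.
Qed.

Lemma rep_average_translate A t x :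
  `|pi t (rep_average pi A x) - rep_average pi A x| <=
  (#|` symdiff A (left_translate t A)|%:R / #|` A|%:R * hnorm x)%:C.
Proof.
rewrite /rep_average linearZ /= -scalerBr normrZ card_inv_real.
rewrite linear_sum /=.
under eq_bigr do rewrite -repM.
rewrite -(sum_left_translate A t (fun s => pi s x)) distrC.
have h := @norm_sum_symdiff A (left_translate t A) (fun s => pi s x) (hnorm x).
apply: le_trans (ler_wpM2l _ (h _)) _.
- by rewrite ler0c invr_ge0 ler0n.
- by move=> s; rewrite rep_norm hnormE.
by rewrite -rmorphM mulrA [X in X * _]mulrC.
Qed.

(** Inversion exchanges the sides: [s^-1 t^-1 = (t s)^-1], so the sum is a difference over [A] and
    its left translate, which the Folner condition controls. *)
Lemma rep_coaverage_coboundary A t x :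
  `|rep_coaverage A (x - pi t^-1%g x)| <=
  (#|` symdiff A (left_translate t A)|%:R / #|` A|%:R * hnorm x)%:C.
Proof.
rewrite /rep_coaverage normrZ card_inv_real.
have -> : \sum_(s <- A) pi s^-1%g (x - pi t^-1%g x) =
   \sum_(s <- A) pi s^-1%g x - \sum_(s <- left_translate t A) pi s^-1%g x.
  rewrite (sum_left_translate A t (fun s => pi s^-1%g x)) -sumrB.
  by apply: eq_bigr => s _; rewrite linearB /= -repM invgM.
have h := @norm_sum_symdiff A (left_translate t A) (fun s => pi s^-1%g x) (hnorm x).
apply: le_trans (ler_wpM2l _ (h _)) _.
- by rewrite ler0c invr_ge0 ler0n.
- by move=> s; rewrite rep_norm hnormE.
by rewrite -rmorphM mulrA [X in X * _]mulrC.
Qed.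

Variables (F : nat -> {fset G}) (F_folner : left_folner R F).

Lemma folner_small t (x : H) (e : R) : 0 < e -> exists N, forall n, (N <= n)%N ->
  #|` symdiff (F n) (left_translate t (F n))|%:R / #|` F n|%:R * hnorm x < e.
Proof.
move=> e0; have x1 : 0 < hnorm x + 1 by rewrite ltr_wpDl ?hnorm_ge0.
have /cvgrPdist_lt/(_ (e / (hnorm x + 1))) := F_folner.2 t.
rewrite divr_gt0 // => /(_ isT)[N _ hN]; exists N => n /hN /=.
rewrite sub0r normrN ger0_norm ?divr_ge0 // ltr_pdivlMr //.
by apply: le_lt_trans; rewrite ler_wpM2l ?lerDl ?divr_ge0.
Qed.

Lemma folner_card n : (#|` F n|%:R : R[i]) != 0.
Proof. by rewrite pnatr_eq0 cardfs_eq0 F_folner.1. Qed.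

Lemma mean_cst n (x : H) : (#|` F n|%:R : R[i])^-1 *: \sum_(s <- F n) x = x.
Proof.
by rewrite sumr_const_fset -[x *+ _]scaler_nat scalerA mulVf ?scale1r ?folner_card.
Qed.

Definition coaverage_cvg : set H :=
  [set u | exists l : H, rep_coaverage (F n) u @[n --> \oo] --> l].

Lemma coaverage_cvg_sub : linear_subspace coaverage_cvg.
Proof.
split.
  rewrite inE; exists 0.
  have -> : (fun n => rep_coaverage (F n) 0) = (fun=> 0).
    apply/funext => n; rewrite /rep_coaverage big1 ?scaler0 // => s _.
    by rewrite linear0.
  exact: cvg_cst.
move=> a u v; rewrite !inE => -[l hl] [m hm]; exists (a *: l + m).
under eq_fun do rewrite rep_coaverage_comb.
by apply: cvgD => //; apply: cvgZl_tmp.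
Qed.

(** The adjoint averages are contractions, uniformly in [n], so the Cauchy property passes to limits
    of vectors. *)
Lemma coaverage_cvg_closed : closed coaverage_cvg.
Proof.
move=> u uK; apply: cauchyC_cvg => e e0.
have e4 : 0 < e / 4 by rewrite divr_gt0.
have /uK[k [[l hl]]] : nbhs u (ball u (e / 4)%:C) by apply: nbhsx_ballx; rewrite ltcR.
rewrite -ball_normE /= => uk.
have [N hN] := (cvgC_P _ _).1 hl _ e4.
exists N => m n Nm Nn.
have d p : `|rep_coaverage (F p) u - rep_coaverage (F p) k| < (e / 4)%:C.
  have -> : rep_coaverage (F p) u - rep_coaverage (F p) k = rep_coaverage (F p) (u - k).
    by rewrite addrC -scaleN1r -rep_coaverage_comb scaleN1r addrC.
  exact: le_lt_trans (rep_coaverage_norm _ _) uk.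
move: (d m) (d n) (hN _ Nm) (hN _ Nn).
move: (rep_coaverage (F m) u) (rep_coaverage (F m) k) (rep_coaverage (F n) u)
  (rep_coaverage (F n) k) => a b a' b' h1 h2 h3 h4.
have -> : a - a' = (a - b) - (l - b) + ((l - b') - (a' - b')).
  by rewrite !opprB !addrA !subrK.
apply: le_lt_trans (ler_normD _ _) _.
have -> : e%:C = ((e / 4)%:C + (e / 4)%:C) + ((e / 4)%:C + (e / 4)%:C).
  by rewrite -!rmorphD; congr (_%:C); field.
apply: ltrD; apply: le_lt_trans (ler_normB _ _) _; exact: ltrD.
Qed.

(** The subspace contains every coboundary [z - pi t^-1 z], hence a vector orthogonal to it is
    invariant. Invariant vectors have constant adjoint averages, so they lie in the subspace too,
    which is therefore everything. *)
Lemma coaverage_cvgT u : coaverage_cvg u.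
Proof.
have [p [Kp pP]] := projection_exists coaverage_cvg_closed coaverage_cvg_sub u.
have inv t : pi t (u - p) = u - p.
  apply: hdot_ext => z; rewrite rep_adjoint; apply/esym/eqP.
  rewrite -subr_eq0 -hdotBr; apply/eqP/pP; exists 0.
  apply/cvgC_P => e /(folner_small t z)[N hN].
  exists N => n /hN h; rewrite sub0r normrN.
  by apply: le_lt_trans (rep_coaverage_coboundary _ _ _) _; rewrite ltcR.
have Kup : coaverage_cvg (u - p).
  exists (u - p).
  have -> : (fun n => rep_coaverage (F n) (u - p)) = (fun=> u - p).
    apply/funext => n; rewrite /rep_coaverage.
    under eq_bigr do rewrite inv.
    exact: mean_cst.
  exact: cvg_cst.
by rewrite -[u](subrK p); apply: subspaceD => //; exact: coaverage_cvg_sub.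
Qed.

Lemma finite_dim_average_cvg v : finite_dimensional H ->
  exists l : H, rep_average pi (F n) v @[n --> \oo] --> l.
Proof.
move=> fd; apply: finite_dim_weak_cvg => // y.
have [l hl] := coaverage_cvgT y; exists (Num.conj (B l v)).
under eq_fun do rewrite rep_average_adjoint hdotC.
by apply: cvgCJ; apply: cvg_hdotl.
Qed.

(** Asymptotic invariance of the averages makes [w] invariant, and [v - w] is orthogonal to the
    invariant vectors because the adjoint averages fix these. *)
Lemma average_lim_eq v w : rep_average pi (F n) v @[n --> \oo] --> w ->
  w = orthproj (invariants pi) v.
Proof.
move=> hw; apply/esym/orthproj_eq.
- split; first by rewrite inE => g; rewrite linear0.
  by move=> a x y; rewrite !inE => hx hy g; rewrite linearP /= hx hy.
- move=> t; apply/eqP; rewrite -subr_eq0; apply/eqP.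
  have h : (pi t (rep_average pi (F n) v) - rep_average pi (F n) v)
      @[n --> \oo] --> (pi t w - w).
    apply: cvgB => //; apply/cvgC_P => e /((cvgC_P _ _).1 hw)[N hN].
    by exists N => n /hN; rewrite -linearB rep_norm.
  have h0 : (pi t (rep_average pi (F n) v) - rep_average pi (F n) v)
      @[n --> \oo] --> (0 : H).
    apply/cvgC_P => e /(folner_small t v)[N hN]; exists N => n /hN h1.
    rewrite sub0r normrN; apply: le_lt_trans (rep_average_translate _ _ _) _.
    by rewrite ltcR.
  by rewrite -(cvg_lim _ h) // (cvg_lim _ h0).
- move=> u hu; rewrite hdotBl.
  have h := @cvg_hdotl R H _ _ u hw.
  have e n : B (rep_average pi (F n) v) u = B v u.
    rewrite rep_average_adjoint; congr (B _ _); rewrite /rep_coaverage.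
    under eq_bigr do rewrite hu.
    exact: mean_cst.
  move: h; under eq_fun do rewrite e.
  move=> h; rewrite -(cvgC_unique h (cvg_cst _)); exact: subrr.
Qed.

End Averages.

(** * States and the GNS construction *)

Section States.
Variables (R : realType) (G : groupType).
Implicit Types (phi : G -> R[i]) (c d : seq (R[i] * G)).

(** This is [phi(d^* c)] for elements of the group algebra, encoded as lists of coefficients and
    group elements; repetitions are allowed. *)
Definition group_form phi c d : R[i] :=
  \sum_(x <- c) \sum_(y <- d) x.1 * Num.conj y.1 * phi (y.2^-1 * x.2)%g.

(** A normalized positive definite function. Positivity is put on the real part, a closed condition
    on real coordinates; the hermitian condition makes the diagonal of the form real. *)
Definition is_state phi := [/\ phi 1%g = 1,
  forall g, phi g^-1%g = Num.conj (phi g) &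
  forall c, 0 <= complex.Re (group_form phi c c)].

Definition group_scale (a : R[i]) c := [seq (a * x.1, x.2) | x <- c].
Definition group_shift (g : G) c := [seq (x.1, g * x.2)%g | x <- c].

Lemma group_form0 phi d : group_form phi [::] d = 0.
Proof. by rewrite /group_form big_nil. Qed.
Lemma group_formD phi c c' d :
  group_form phi (c ++ c') d = group_form phi c d + group_form phi c' d.
Proof. by rewrite /group_form big_cat. Qed.
Lemma group_formZ phi a c d :
  group_form phi (group_scale a c) d = a * group_form phi c d.
Proof.
rewrite /group_form big_map mulr_sumr; apply: eq_bigr => x _.
by rewrite mulr_sumr; apply: eq_bigr => y _ /=; rewrite !mulrA.
Qed.
Lemma group_form_shift phi g c d :
  group_form phi (group_shift g c) (group_shift g d) = group_form phi c d.
Proof.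
rewrite /group_form big_map; apply: eq_bigr => x _.
rewrite big_map; apply: eq_bigr => y _ /=.
by rewrite invgM mulgA mulgVK.
Qed.
Lemma group_shiftM g h c : group_shift (g * h)%g c = group_shift g (group_shift h c).
Proof. by rewrite /group_shift -map_comp; apply: eq_map => x /=; rewrite mulgA. Qed.
Lemma group_shift1 c : group_shift 1%g c = c.
Proof. by rewrite -[RHS]map_id; apply: eq_map => -[a g] /=; rewrite mul1g. Qed.

(** * Vector states; extremality implies irreducibility *)

Section VectorState.
Variables (H : hilbertType R) (pi : unitary_rep G H).

Definition group_act c (v : H) : H := \sum_(x <- c) x.1 *: pi x.2 v.

Lemma group_form_act phi v c : (forall g, phi g = hdot H (pi g v) v) ->
  group_form phi c c = (hsq (group_act c v))%:C.
Proof.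
move=> hphi; rewrite -hsqE hdot_suml; apply: eq_bigr => x _.
rewrite hdotC hdot_suml rmorph_sum; apply: eq_bigr => y _ /=.
rewrite -hdotC hdotZl hdotZr hphi repM rep_adjoint invgK.
by rewrite mulrA mulrC.
Qed.

Lemma vector_state v : hsq v = 1 -> is_state (fun g => hdot H (pi g v) v).
Proof.
move=> v1; split.
- by rewrite rep1 hsqE v1.
- by move=> g; rewrite -hdotC rep_adjoint invgK.
- by move=> c; rewrite (@group_form_act _ v c) //= hsq_ge0.
Qed.

(** Concluding for [alpha] suffices: exchanging [t] and [1 - t] gives [beta]. *)
Definition extreme_state phi := is_state phi /\
  forall alpha beta (t : R), is_state alpha -> is_state beta -> 0 < t < 1 ->
    (forall g, phi g = t%:C * alpha g + (1 - t)%:C * beta g) -> alpha =1 phi.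

(** Let [xi = q + p] with [p] in the invariant subspace [K] and [q] orthogonal to it. The cross
    terms of the coefficient of [xi] vanish, as the complement is invariant too, so [phi] is the
    mean of the states of the normalized [p] and [q] with weights [hsq p] and [hsq q]. If both are
    nonzero, extremality forces [p] to be a multiple of [xi], which puts [xi] in [K] and makes [q]
    zero. *)
Lemma extreme_irreducible xi phi : extreme_state phi ->
  (forall g, phi g = hdot H (pi g xi) xi) ->
  (forall w, (forall g, hdot H (pi g xi) w = 0) -> w = 0) ->
  irreducible_rep pi.
Proof.
move=> [phi_state phi_ext] phiE cyc.
have [phi1 _ _] := phi_state.
have xi1 : hsq xi = 1.
  by apply: complexI; rewrite -hsqE -{1}[xi](rep1 pi) -phiE.
split.
  exists xi; apply/eqP => xi0.
  by move/eqP: xi1; rewrite xi0 /hsq /ph_sq /= linear0l eq_sym oner_eq0.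
move=> K Kcl Ksub Kinv.
have [p [Kp pP]] := projection_exists Kcl Ksub xi.
move: (xi - p) pP (subrK p xi) => q pP xiE.
have qP g w : K w -> hdot H (pi g q) w = 0.
  by move=> Kw; rewrite rep_adjoint pP //; apply: Kinv.
have pq g w : K w -> hdot H (pi g xi) w = hdot H (pi g p) w.
  by move=> Kw; rewrite -xiE (linearD (pi g)) /= hdotDl qP // add0r.
have [p0|p0] := eqVneq p 0.
  left; apply/seteqP; split=> [w Kw|w ->]; last exact: subspace0 Ksub.
  by apply: cyc => g; rewrite pq // p0 linear0 hdot0l.
have [q0|q0] := eqVneq q 0.
  right; apply/seteqP; split=> // h _.
  have Kxi : K xi by rewrite -xiE q0 add0r.
  have [r [Kr rP]] := projection_exists Kcl Ksub h.
  suff : h - r = 0 by move/eqP; rewrite subr_eq0 => /eqP ->.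
  by apply: cyc => g; rewrite hdotC rP ?conjC0 //; apply: Kinv.
have sum1 : hsq p + hsq q = 1.
  rewrite -xi1 -xiE [RHS]hsqD.
  by rewrite (pP p Kp) mulr0 addr0 addrC.
have pos (x : H) : x != 0 -> 0 < hsq x.
  move=> x0; rewrite lt_neqAle hsq_ge0 andbT eq_sym.
  by apply: contra_neq x0; apply: hsq_eq0.
have pp := pos _ p0; have qq := pos _ q0.
pose nrm (x : H) := (Num.sqrt (hsq x))^-1%:C *: x.
have nrmP (x : H) : x != 0 -> hsq (nrm x) = 1.
  move=> /pos x0; rewrite hsqZ /= [0 ^+ 2]mulr0 addr0 exprVn sqr_sqrtr ?ltW //.
  by rewrite mulVf // gt_eqF.
have nrmE g (x : H) : x != 0 ->
    (hsq x)%:C * hdot H (pi g (nrm x)) (nrm x) = hdot H (pi g x) x.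
  move=> /pos x0; rewrite /nrm (linearZ_LR (pi g)) /= hdotZl hdotZr conjC_real.
  rewrite !mulrA -!rmorphM /=.
  rewrite -mulrA -invfM -expr2 sqr_sqrtr ?ltW // divff ?gt_eqF //.
  by rewrite mul1r.
have := phi_ext _ _ (hsq p) (vector_state (nrmP _ p0)) (vector_state (nrmP _ q0)).
rewrite pp /=.
have -> : hsq p < 1 by rewrite -sum1 ltrDl.
have -> : 1 - hsq p = hsq q by rewrite -sum1 addrC addKr.
have dec g : phi g = (hsq p)%:C * hdot H (pi g (nrm p)) (nrm p) +
    (hsq q)%:C * hdot H (pi g (nrm q)) (nrm q).
  rewrite !nrmE // phiE -xiE (linearD (pi g)) /= hdotDl !hdotDr.
  have -> : hdot H (pi g p) q = 0 by rewrite rep_adjoint hdotC qP ?conjC0.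
  by rewrite (qP _ _ Kp) addr0 add0r addrC.
move=> /(_ isT dec) ext.
(* Pairing [pi g xi] with [p] gives the coefficient of [p], which extremality identifies with
   [hsq p] times [phi g]; so the difference is orthogonal to the orbit of [xi]. *)
have pxi : p = (hsq p)%:C *: xi.
  apply/eqP; rewrite -subr_eq0; apply/eqP/cyc => g.
  rewrite hdotBr hdotZr conjC_real -phiE -ext /= nrmE // pq //.
  exact: subrr.
have Kxi : K xi.
  have -> : xi = (hsq p)^-1%:C *: p.
    by rewrite {2}pxi scalerA -rmorphM mulVf ?scale1r // gt_eqF.
  exact: subspaceZ.
exfalso; move/eqP: q0; apply; apply: hsq_eq0; apply: complexI; rewrite -hsqE.
apply: pP; have -> : q = (-1) *: p + xi by rewrite -xiE scaleN1r addrC addrK.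
exact: subspace_comb.
Qed.

End VectorState.

(** * The GNS representation of a state *)

Section GNS.
Variables (phi : G -> R[i]) (phi_state : is_state phi).

Lemma group_formC c d : group_form phi d c = Num.conj (group_form phi c d).
Proof.
have [_ phiV _] := phi_state.
rewrite /group_form exchange_big rmorph_sum; apply: eq_bigr => x _.
rewrite rmorph_sum; apply: eq_bigr => y _ /=.
rewrite !rmorphM /= conjCK -phiV invgM invgK; congr (_ * _).
by rewrite mulrC.
Qed.

Lemma group_form_ge0 c : 0 <= group_form phi c c.
Proof.
have [_ _ /(_ c) h] := phi_state.
by rewrite -[group_form _ _ _]RRe_real ?ler0c // CrealE -group_formC.
Qed.

(** The group algebra with the form of [phi]. Null vectors need no separate treatment: they define
    the zero functional and so become 0 in the completion. *)
Definition gns_preHilbert : preHilbert R :=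
  @PreHilbert R (seq (R[i] * G)) [::] cat group_scale (group_form phi)
  (group_form0 phi) (group_formD phi) (group_formZ phi) group_formC group_form_ge0.

Definition gns_space := completion_hilbert gns_preHilbert.

Lemma gns_shift_form g (c d : gns_preHilbert) :
  ph_form (group_shift g c : gns_preHilbert) d =
  ph_form c (group_shift g^-1%g d : gns_preHilbert).
Proof.
by rewrite -[RHS](@group_form_shift phi g) -group_shiftM mulgV group_shift1.
Qed.

Lemma gns_shift_norm g (c d : gns_preHilbert) :
  ph_norm (ph_sub (group_shift g c : gns_preHilbert) (group_shift g d)) =
  ph_norm (ph_sub c d).
Proof.
rewrite /ph_norm /ph_sq !(ph_formB, ph_formBr).
by do 4 rewrite [ph_form (group_shift g _ : gns_preHilbert) _]group_form_shift.
Qed.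

(** The adjoint of the shift by [g] is the shift by [g^-1], so translating the argument extends the
    shift to functionals. No representative is chosen, and the laws of a representation hold
    argumentwise. *)
Definition gns_fun g (f : completion gns_preHilbert) : gns_preHilbert -> R[i]^o :=
  fun x => f (group_shift g^-1%g x).

Lemma gns_completes g (c : nat -> gns_preHilbert)
    (f : completion gns_preHilbert) : completes c f ->
  completes (fun n => group_shift g (c n) : gns_preHilbert) (gns_fun g f).
Proof.
move=> [hc hf]; split.
  move=> e /hc[N hN]; exists N => m n Nm Nn; rewrite gns_shift_norm; exact: hN.
by move=> x; under eq_fun do rewrite gns_shift_form; exact: hf.
Qed.

Lemma gns_subproof g f : gns_fun g f \in @completion_pred R gns_preHilbert.
Proof.
by apply/asboolP; exists (fun n => group_shift g (rep f n)); apply/gns_completes/repP.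
Qed.

Definition gns_op g (f : gns_space) : gns_space := Completion (gns_subproof g f).

Lemma gns_op_linear g : linear (gns_op g).
Proof. by move=> a u v; apply/val_inj/funext. Qed.
HB.instance Definition _ g :=
  GRing.isLinear.Build R[i] gns_space gns_space *:%R (gns_op g) (gns_op_linear g).

Lemma gns_op1 f : gns_op 1%g f = f.
Proof. by apply/val_inj/funext => x /=; rewrite /gns_fun invg1 group_shift1. Qed.
Lemma gns_opM g h f : gns_op (g * h)%g f = gns_op g (gns_op h f).
Proof. by apply/val_inj/funext => x /=; rewrite /gns_fun invgM group_shiftM. Qed.

Lemma gns_op_unitary g : unitary_op (gns_op g).
Proof.
split.
  by exists (gns_op g^-1%g) => f; rewrite -gns_opM ?mulgV ?mulVg gns_op1.
move=> f h.
have hf := repP f; have hh := repP h.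
have := completion_formE (gns_completes g hf : completes _ (gns_op g f))
  (gns_completes g hh : completes _ (gns_op g h)).
under eq_fun do rewrite [ph_form _ _]group_form_shift.
move=> hl; apply: (cvgC_unique hl); exact: completion_formE.
Qed.

Definition gns_rep : unitary_rep G gns_space :=
  @UnitaryRep R G gns_space (fun g => gns_op g) gns_op_unitary gns_op1 gns_opM.

Definition gns_vector : gns_space := embed ([:: (1, 1%g)] : gns_preHilbert).

Lemma gns_orbit g : gns_rep g gns_vector = embed ([:: (1, g)] : gns_preHilbert).
Proof.
apply/val_inj/funext => x.
transitivity (group_form phi (group_shift g [:: (1, 1%g)]) x).
  exact/esym/gns_shift_form.
by rewrite /= mulg1.
Qed.

Lemma gns_state g : phi g = hdot gns_space (gns_rep g gns_vector) gns_vector.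
Proof.
rewrite gns_orbit [RHS]completion_form_embed /= /embed_fun /= /group_form !big_seq1.
by rewrite /= conjC1 !mul1r invg1 mul1g.
Qed.

(** By the reproducing identity it suffices that [w] be orthogonal to every embedded list, and such
    a list is a finite combination of orbit vectors. *)
Lemma gns_cyclic (w : gns_space) :
  (forall g, hdot gns_space (gns_rep g gns_vector) w = 0) -> w = 0.
Proof.
move=> hw; apply/val_inj/funext => x.
have e (y : gns_preHilbert) : hdot gns_space w (embed y) = (w : completion _) y.
  exact: completion_form_embed.
transitivity (hdot gns_space w (embed (x : gns_preHilbert))).
  exact/esym/e.
elim: x => [|[a g] x IH].
  rewrite -[RHS](hdot0r w); congr (hdot _ _ _).
  by apply/val_inj/funext => y /=; rewrite /embed_fun /= group_form0.
have -> : embed ((a, g) :: x : gns_preHilbert) =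
    a *: gns_rep g gns_vector + embed (x : gns_preHilbert).
  rewrite gns_orbit; apply/val_inj/funext => y.
  transitivity (group_form phi (group_scale a [:: (1, g)] ++ x) y).
    by rewrite /= mulr1.
  by rewrite group_formD group_formZ.
by rewrite [LHS]hdotDr hdotZr hdotC hw conjC0 mulr0 add0r IH.
Qed.

End GNS.

(** The Moore property enters here. Any one vector with state [phi] serves the purpose, since the
    squared norms in question are determined by the state. *)
Lemma extreme_state_average_cvg phi (F : nat -> {fset G}) :
  moore_group R G -> left_folner R F -> extreme_state phi ->
  exists (H : hilbertType R) (pi : unitary_rep G H) (xi : H),
    (forall g, phi g = hdot H (pi g xi) xi) /\
    exists l : H, rep_average pi (F n) xi @[n --> \oo] --> l.
Proof.
move=> moore folner phi_ext; have phi_state := phi_ext.1.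
exists (gns_space phi_state), (gns_rep phi_state), (gns_vector phi_state).
split; first exact: gns_state.
apply: finite_dim_average_cvg => //; apply: moore.
apply: (extreme_irreducible phi_ext (gns_state phi_state)).
exact: gns_cyclic.
Qed.

End States.

(** * Simons' inequality *)

Section GeometricSums.
Variable R : realType.
Implicit Types (a b : nat -> R) (M c : R).

(** The weights [2^-(k+1)] sum to 1, so that the limit [gsum] is a countable convex combination. *)
Definition gpart a n : R := \sum_(k < n) 2^-1 ^+ k.+1 * a k.
Definition gsum a : R := limn (gpart a).

Lemma gpartS a n : gpart a n.+1 = gpart a n + 2^-1 ^+ n.+1 * a n.
Proof. by rewrite /gpart big_ord_recr. Qed.

Lemma half_expn_gt0 n : 0 < 2^-1 ^+ n :> R.
Proof. by rewrite exprn_gt0. Qed.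

Lemma gpart_le a c n : (forall k, a k <= c) -> gpart a n <= c * (1 - 2^-1 ^+ n).
Proof.
move=> ac; elim: n => [|n IH]; first by rewrite /gpart big_ord0 subrr mulr0.
rewrite gpartS; have := ler_wpM2l (ltW (half_expn_gt0 n.+1)) (ac n).
move: IH; rewrite exprS; move: (2^-1 ^+ n) => q; lra.
Qed.

Lemma gpart_ge a c n : (forall k, c <= a k) -> c * (1 - 2^-1 ^+ n) <= gpart a n.
Proof.
move=> ac; elim: n => [|n IH]; first by rewrite /gpart big_ord0 subrr mulr0.
rewrite gpartS; have := ler_wpM2l (ltW (half_expn_gt0 n.+1)) (ac n).
move: IH; rewrite exprS; move: (2^-1 ^+ n) => q; lra.
Qed.

Lemma gsum_cvg a M : (forall k, 0 <= a k <= M) -> gpart a n @[n --> \oo] --> gsum a.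
Proof.
move=> aM; have a0 k : 0 <= a k by case/andP: (aM k).
apply: nondecreasing_is_cvgn.
  apply/nondecreasing_seqP => n; rewrite gpartS lerDl.
  by apply: mulr_ge0 => //; exact/ltW/half_expn_gt0.
exists M => _ [n _ <-]; apply: le_trans (gpart_le n (c := M) _) _.
  by move=> k; case/andP: (aM k).
have M0 : 0 <= M by apply: le_trans (a0 0) _; case/andP: (aM 0).
by rewrite ler_piMr // gerDl oppr_le0 ltW // half_expn_gt0.
Qed.

Lemma cvg_half : (2^-1 : R) ^+ n @[n --> \oo] --> (0 : R).
Proof.
have -> : (fun n => (2^-1 : R) ^+ n) = geometric 1 2^-1.
  by apply/funext => n; rewrite /= mul1r.
by apply: cvg_geometric; rewrite ger0_norm // invf_lt1 // ltr1n.
Qed.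

Lemma gsum_le a M c : (forall k, 0 <= a k <= M) -> (forall k, a k <= c) -> gsum a <= c.
Proof.
move=> aM ac; apply: limr_le; first exact/cvgP/gsum_cvg/aM.
have c0 : 0 <= c by apply: le_trans (ac 0); case/andP: (aM 0).
apply: nearW => n; apply: le_trans (gpart_le n ac) _.
by rewrite ler_piMr // gerDl oppr_le0 ltW // half_expn_gt0.
Qed.

Lemma gsum_ge a M c : (forall k, 0 <= a k <= M) -> (forall k, c <= a k) -> c <= gsum a.
Proof.
move=> aM ac.
have h : c * (1 - 2^-1 ^+ n) @[n --> \oo] --> c.
  rewrite -[X in _ --> X]mulr1 -[X in _ * X]subr0.
  by apply: cvgM; [exact: cvg_cst|apply: cvgB; [exact: cvg_cst|exact: cvg_half]].
rewrite -(cvg_lim _ h) //; apply: ler_lim; first exact: cvgP h.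
  exact/cvgP/gsum_cvg/aM.
by apply: nearW => n; exact: gpart_ge.
Qed.

Lemma gsum_lin a b M N (s t : R) : (forall k, 0 <= a k <= M) ->
  (forall k, 0 <= b k <= N) ->
  gsum (fun k => s * a k + t * b k) = s * gsum a + t * gsum b.
Proof.
move=> /gsum_cvg ha /gsum_cvg hb; apply: cvg_lim => //.
have -> : gpart (fun k => s * a k + t * b k) =
    (fun n => s * gpart a n + t * gpart b n).
  apply/funext => n; rewrite /gpart !mulr_sumr -big_split; apply: eq_bigr => k _ /=.
  by rewrite mulrDr !(mulrCA (2^-1 ^+ _)).
by apply: cvgD; (apply: cvgM; first exact: cvg_cst).
Qed.

(** The weights are self-similar: from index [n] on they are [2^-n] times the original ones. *)
Lemma gsum_split a M n : (forall k, 0 <= a k <= M) ->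
  gsum a = gpart a n + 2^-1 ^+ n * gsum (fun k => a (n + k)%N).
Proof.
move=> aM; have := gsum_cvg (fun k => aM (n + k)%N).
move=> h'; apply: cvg_lim => //; rewrite -(cvg_shiftn n).
have -> : (fun m => gpart a (m + n)) =
    (fun m => gpart a n + 2^-1 ^+ n * gpart (fun k => a (n + k)%N) m).
  apply/funext => m; elim: m => [|m IH].
    by rewrite add0n /gpart big_ord0 mulr0 addr0.
  by rewrite addSn !gpartS IH mulrDr addrA mulrA -exprD addnS [(m + n)%N]addnC.
apply: cvgD; first exact: cvg_cst.
by apply: cvgM => //; exact: cvg_cst.
Qed.

Lemma gsum_eq0 a M k : (forall k, 0 <= a k <= M) -> gsum a <= 0 -> a k = 0.
Proof.
move=> aM; have a0 j : 0 <= a j by case/andP: (aM j).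
rewrite (gsum_split k.+1 aM) gpartS => h.
have g1 : 0 <= gpart a k by have := gpart_ge k a0; rewrite mul0r.
have g2 : 0 <= gsum (fun j => a (k.+1 + j)%N).
  by apply: (gsum_ge (M := M)) => j; rewrite ?aM ?a0.
have g3 := mulr_ge0 (ltW (half_expn_gt0 k.+1)) g2.
have g4 := mulr_ge0 (ltW (half_expn_gt0 k.+1)) (a0 k).
have : 2^-1 ^+ k.+1 * a k = 0 by lra.
by move/eqP; rewrite mulf_eq0 gt_eqF ?half_expn_gt0 //= => /eqP.
Qed.

End GeometricSums.

Section Simons.
Variables (R : realType) (T : Type) (K : set T) (t0 : T) (Bd : set T).
Variables (Adm : set (T -> R)) (M eps : R) (x : nat -> T -> R).
Hypotheses (Kt0 : K t0) (eps0 : 0 < eps).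
Hypotheses (Adm_x : forall k, Adm (x k)) (x_bd : forall k t, K t -> 0 <= x k t <= M).
Hypothesis Adm_gsum : forall y : nat -> T -> R, (forall k, Adm (y k)) ->
  (forall k t, K t -> 0 <= y k t <= M) -> Adm (fun t => gsum (y^~ t)).
(** [Bd] is a boundary of [K] for the admissible functions. In the application [K] is the set of
    states, [Adm] the continuous affine functions and [Bd] the extreme states; the inequality itself
    involves no topology on [T]. *)
Hypothesis Bd_max : forall h, Adm h -> (forall t, K t -> 0 <= h t <= M) ->
  exists b, [/\ Bd b, K b & forall t, K t -> h t <= h b].

(* Only the properties of the convex hull of [x k], [k >= n], that survive
   countable convex combinations are recorded. *)
Definition tail_hull n : set (T -> R) := [set h | [/\ Adm h,
  forall t, K t -> 0 <= h t <= M, eps <= h t0 &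
  forall t c, K t -> (forall k, (n <= k)%N -> x k t <= c) -> h t <= c]].

Lemma tail_hull_gsum n (y : nat -> T -> R) :
  (forall k, tail_hull (n + k) (y k)) -> tail_hull n (fun t => gsum (y^~ t)).
Proof.
move=> hy.
have yM k t : K t -> 0 <= y k t <= M by case: (hy k) => _ + _ _; apply.
split.
- by apply: Adm_gsum => // k; case: (hy k).
- move=> t Kt; have yt k := yM k t Kt; rewrite (gsum_ge yt) ?(gsum_le yt) // => k.
    by case/andP: (yt k).
  by case/andP: (yt k).
- by apply: (gsum_ge (M := M)) => k; [exact: yM|case: (hy k)].
- move=> t c Kt hc; apply: (gsum_le (M := M)) => k; first exact: yM.
  case: (hy k) => _ _ _; apply => // j nj; apply: hc; apply: leq_trans nj.
  exact: leq_addr.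
Qed.

Definition supK (h : T -> R) := sup (h @` K).

Lemma supK_ge h W t : (forall t, K t -> h t <= W) -> K t -> h t <= supK h.
Proof.
move=> hW Kt; apply: ub_le_sup; last by exists t.
by exists W => _ [s Ks <-]; exact: hW.
Qed.

Lemma supK_le h W : (forall t, K t -> h t <= W) -> supK h <= W.
Proof.
move=> hW; apply: ge_sup; first by exists (h t0), t0.
by move=> _ [t Kt <-]; exact: hW.
Qed.

(** The suprema are bounded below by the value at [t0], where every function of the hull is at least
    [eps]; a near-minimizer thus exists. *)
Lemma greedy_step n (w : T -> R) (s d : R) : 0 <= s -> 0 < d ->
  tail_hull n !=set0 -> (exists W, forall t, K t -> w t <= W) ->
  exists y, tail_hull n y /\ forall z, tail_hull n z ->
    supK (fun t => w t + s * y t) <= supK (fun t => w t + s * z t) + d.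
Proof.
move=> s0 d0 [x0 hx0] [W hW].
have ub z : tail_hull n z -> forall t, K t -> w t + s * z t <= W + s * M.
  move=> [_ zM _ _] t Kt; apply: lerD; first exact: hW.
  by apply: ler_wpM2l => //; case/andP: (zM t Kt).
pose E := [set supK (fun t => w t + s * z t) | z in tail_hull n].
have Elb : has_lbound E.
  exists (w t0 + s * eps) => _ [z hz <-].
  apply: le_trans (supK_ge (ub z hz) Kt0); rewrite lerD2l ler_wpM2l //.
  by case: hz.
have E0 : has_inf E by split => //; exists (supK (fun t => w t + s * x0 t)), x0.
have [_ [y hy <-] hlt] := inf_adherent d0 E0.
exists y; split=> // z hz; apply: le_trans (ltW hlt) _; rewrite lerD2r.
by apply: ge_inf => //; exists z.
Qed.

(* Simons' inequality.  The [y n] are chosen greedily in the hull of the tails,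
   so that [sum_k 2^-(k+1) y k] nearly minimizes its supremum at every stage;
   at a maximum point [b] in the boundary each tail mean is then [>= eps / 2]. *)
Theorem simons : (forall k, eps <= x k t0) ->
  (forall b, Bd b -> K b -> forall e, 0 < e ->
    exists N, forall k, (N <= k)%N -> x k b <= e) ->
  False.
Proof.
move=> x_t0 x_Bd.
have hull_x n : tail_hull n (x n) by split => //; [exact: x_bd|move=> t c _; apply].
(* One factor [2^-n] is lost when dividing by the tail weight; the other makes the errors sum to
   [eps / 2], leaving half of the initial [eps]. *)
pose dl n : R := eps / 4 * (2^-1 ^+ n * 2^-1 ^+ n).
have dl0 n : 0 < dl n by rewrite !mulr_gt0 ?half_expn_gt0.
(* The recursion for [w] needs a total [Y], so boundedness of the partial sum is a premise inside
   the choice, discharged along the recursion. *)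
have /choice[Y hY] (nw : nat * (T -> R)) : exists y,
    (exists W, forall t, K t -> nw.2 t <= W) -> tail_hull nw.1 y /\
    forall z, tail_hull nw.1 z ->
    supK (fun t => nw.2 t + 2^-1 ^+ nw.1 * y t) <=
    supK (fun t => nw.2 t + 2^-1 ^+ nw.1 * z t) + dl nw.1.
  have [hW|nW] := pselect (exists W, forall t, K t -> nw.2 t <= W); last first.
    by exists (x 0) => /nW.
  have [|y hy] := @greedy_step nw.1 nw.2 _ _ (ltW (half_expn_gt0 _ nw.1))
    (dl0 nw.1) _ hW.
    by exists (x nw.1).
  by exists y.
(* [Y (n, w n)] is optimized with weight [2^-n], the mass of all remaining terms, but is added with
   only half of it, [2^-(n+1)]. *)
pose w := fix w n := if n is m.+1 then
  (fun t => w m t + 2^-1 ^+ m.+1 * Y (m, w m) t) else (fun _ : T => 0 : R).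
pose y n := Y (n, w n).
have wE n t : w n t = gpart (y^~ t) n.
  elim: n => [|n IH]; first by rewrite /gpart big_ord0.
  by rewrite gpartS /= IH.
have wW n : (exists W, forall t, K t -> w n t <= W) /\ tail_hull n (y n).
  elim: n => [|n [[W hW] hy]].
    have b0 : exists W, forall t, K t -> w 0 t <= W by exists 0.
    by split => //; have [] := hY (0, w 0) b0.
  have b1 : exists W, forall t, K t -> w n.+1 t <= W.
    exists (W + 2^-1 ^+ n.+1 * M) => t Kt; apply: lerD; first exact: hW.
    apply: ler_wpM2l; first exact/ltW/half_expn_gt0.
    have /andP[_ h] : 0 <= y n t <= M by case: hy => _ + _ _; apply.
    exact: h.
  by split => //; have [] := hY (n.+1, w n.+1) b1.
have hull_y n : tail_hull n (y n) := (wW n).2.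
have yM k t : K t -> 0 <= y k t <= M by case: (hull_y k) => _ + _ _; apply.
pose z n t := gsum (fun k => y (n + k)%N t).
have hull_z n : tail_hull n (z n).
  by apply: (@tail_hull_gsum n (fun k => y (n + k)%N)) => k; exact: hull_y.
have split_z n t : K t -> z 0 t = w n t + 2^-1 ^+ n * z n t.
  by move=> Kt; rewrite wE; apply: (@gsum_split R _ M) => k; exact: yM.
have [Adm0 z0M z0eps _] := hull_z 0.
have [b [Bdb Kb bmax]] := Bd_max Adm0 z0M.
(* The competitor is the tail mean [z n]: with it the supremum is that of [z 0], reached at [b].
   Near-optimality gives [y n b <= z n b + eps/4 2^-n], and [z n] is the midpoint of [y n] and
   [z n.+1]. *)
have step n : z n b <= z n.+1 b + eps / 4 * 2^-1 ^+ n.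
  have [_ /(_ _ (hull_z n))/= opt] := hY (n, w n) (wW n).1.
  have s0 : supK (fun t => w n t + 2^-1 ^+ n * z n t) <= z 0 b.
    by apply: supK_le => t Kt; rewrite -split_z // bmax.
  have s1 : w n b + 2^-1 ^+ n * y n b <=
      supK (fun t => w n t + 2^-1 ^+ n * Y (n, w n) t).
    have [W hW] := (wW n).1.
    apply: (@supK_ge (fun t => w n t + 2^-1 ^+ n * Y (n, w n) t)
      (W + 2^-1 ^+ n * M)) => // t Kt.
    apply: lerD; first exact: hW.
    apply: ler_wpM2l; first exact/ltW/half_expn_gt0.
    by case/andP: (yM n t Kt).
  have e0 := split_z n b Kb; have e1 := split_z n.+1 b Kb.
  have e2 : w n.+1 b = w n b + 2^-1 ^+ n.+1 * y n b by [].
  have hn := half_expn_gt0 R n.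
  rewrite -(ler_pM2l hn) mulrDr (mulrCA (2^-1 ^+ n)) -/(dl n).
  move: e1 e2; rewrite exprS; move: opt s0 s1 e0; move: (supK _) (supK _).
  move: (2^-1 ^+ n) (dl n) => q d p1 p2 opt s0 s1 e0 e1 e2.
  lra.
have low n : eps / 2 + eps / 2 * 2^-1 ^+ n <= z n b.
  elim: n => [|n IH]; first by have := bmax _ Kt0; rewrite expr0; lra.
  by have := step n; rewrite exprS; lra.
have [|N hN] := x_Bd b Bdb Kb (eps / 4); first by rewrite divr_gt0.
have [_ _ _ /(_ b (eps / 4) Kb hN)] := hull_z N.
have := low N; have := mulr_gt0 eps0 (half_expn_gt0 R N).
move: eps0 (2^-1 ^+ N) => e0 q h1 h2 h3.
have h4 := le_trans h2 h3; lra.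
Qed.

End Simons.

(** * The compact convex set of states *)

Section ContinuousOn.
Variables (R : realType) (T : topologicalType).
Implicit Types (K : set T) (h : T -> R).

(** Continuity is relative to [K] because the infinite sums [gsum] are controlled on [K] only. *)
Definition cont_on K h := forall t, K t -> h s @[s --> within K (nbhs t)] --> h t.

Lemma cont_onP K h : cont_on K h <-> forall t, K t -> forall e, 0 < e ->
  \forall s \near t, K s -> `|h t - h s| <= e.
Proof.
split=> hc t Kt; first by move=> e e0; have /cvgrPdist_le/(_ e e0) := hc t Kt.
by apply/cvgrPdist_le => e e0; exact: (hc t Kt e e0).
Qed.

Lemma cont_on_sub K K' h : K' `<=` K -> cont_on K h -> cont_on K' h.
Proof.
move=> K'K /cont_onP hc; apply/cont_onP => t K't e e0.
by apply: filterS (hc t (K'K _ K't) e e0) => s hs /K'K.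
Qed.

Lemma cont_on_within K h : cont_on K h -> {within K, continuous h}.
Proof. by move=> hc; apply/subspace_continuousP. Qed.

Lemma cont_onT K h : continuous h -> cont_on K h.
Proof.
move=> hc; apply/cont_onP => t Kt e e0.
have /cvgrPdist_le/(_ e e0) := hc t; by apply: filterS.
Qed.

Lemma closure_ge K K' h t (c : R) : cont_on K h -> K' `<=` K -> closure K' t -> K t ->
  (forall s, K' s -> c <= h s) -> c <= h t.
Proof.
move=> /cont_onP hc K'K clt Kt hK'; apply/ler_addgt0Pr => e e0.
have [s [K's /(_ (K'K _ K's))]] := clt _ (hc t Kt e e0).
rewrite ler_distl => /andP[+ _]; have := hK' s K's; lra.
Qed.

(** Uniform convergence: on [K] the remainder after [n] terms is at most [2^-n M]. *)
Lemma cont_on_gsum K (y : nat -> T -> R) (M : R) : (forall k, cont_on K (y k)) ->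
  (forall k t, K t -> 0 <= y k t <= M) -> cont_on K (fun t => gsum (y^~ t)).
Proof.
move=> yc yM.
have gc n : cont_on K (fun t => gpart (y^~ t) n).
  elim: n => [|n IH] t Kt.
    by under eq_fun do rewrite /gpart big_ord0; rewrite /gpart big_ord0; exact: cvg_cst.
  rewrite gpartS; under eq_fun do rewrite gpartS.
  by apply: cvgD; [exact: IH|apply: cvgM; [exact: cvg_cst|exact: yc]].
apply/cont_onP => t Kt e e0.
have M0 : 0 <= M by case/andP: (yM 0 t Kt); exact: le_trans.
have [n hn] : exists n, 2^-1 ^+ n * M <= e / 2.
  have e1 : 0 < e / 2 / (M + 1) by rewrite !divr_gt0 // ltr_wpDl.
  have /cvgrPdist_le/(_ _ e1)[N _ hN] := @cvg_half R.
  exists N; have := hN N (leqnn _).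
  rewrite /= sub0r normrN (ger0_norm (ltW (half_expn_gt0 _ _))).
  rewrite ler_pdivlMr ?ltr_wpDl //; apply: le_trans.
  by rewrite ler_wpM2l ?lerDl // ltW // half_expn_gt0.
have e20 : 0 < e / 2 by rewrite divr_gt0.
have tail s : K s -> 0 <= gsum (y^~ s) - gpart (y^~ s) n <= e / 2.
  move=> Ks; have ys k := yM k s Ks.
  rewrite (gsum_split n ys) addrAC subrr add0r.
  have yns k : 0 <= y (n + k)%N s <= M by exact: ys.
  apply/andP; split.
    apply: mulr_ge0; first exact/ltW/half_expn_gt0.
    by apply: (gsum_ge yns) => k; case/andP: (yns k).
  apply: le_trans hn; apply: ler_wpM2l; first exact/ltW/half_expn_gt0.
  by apply: (gsum_le yns) => k; case/andP: (yns k).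
have /cont_onP/(_ t Kt _ e20) := gc n.
apply: filterS => s + Ks => /(_ Ks).
have := tail _ Kt; have := tail _ Ks.
rewrite !ler_norml; move: (gsum _) (gsum _) (gpart _ _) (gpart _ _) => a b c d.
move=> /andP[h1 h2] /andP[h3 h4] /andP[h5 h6]; apply/andP; split; lra.
Qed.

Lemma sum_continuous I (s : seq I) (f : I -> T -> R) :
  (forall i, continuous (f i)) -> continuous (fun t => \sum_(i <- s) f i t).
Proof.
move=> fc; elim: s => [|i s IH].
  have -> : (fun t => \sum_(i <- [::]) f i t) = (fun=> 0).
    by apply/funext => t; rewrite big_nil.
  by move=> t; exact: cvg_cst.
have -> : (fun t => \sum_(j <- i :: s) f j t) =
    (fun t => f i t + \sum_(j <- s) f j t).
  by apply/funext => t; rewrite big_cons.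
by move=> t; apply: cvgD; [exact: fc|exact: IH].
Qed.

Lemma lincomb_continuous (f g : T -> R) (a b : R) : continuous f -> continuous g ->
  continuous (fun t => a * f t - b * g t).
Proof.
move=> fc gc t; apply: cvgB; apply: cvgM; try exact: cvg_cst.
  exact: fc.
exact: gc.
Qed.

Lemma continuous_closure_ge K h t (c : R) : continuous h -> closure K t ->
  (forall s, K s -> c <= h s) -> c <= h t.
Proof.
move=> hc ct hK.
exact: (closure_ge (cont_onT (K := setT) hc) (@subsetT _ _) ct I hK).
Qed.

Lemma continuous_closure_eq K h h' t : continuous h -> continuous h' -> closure K t ->
  (forall s, K s -> h s = h' s) -> h t = h' t.
Proof.
move=> hc hc' ct hK; apply/eqP; rewrite eq_le; apply/andP; split; rewrite -subr_ge0.
  apply: (@continuous_closure_ge K (fun s => h' s - h s)) => // [s|s /hK ->].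
    by apply: cvgB; [exact: hc'|exact: hc].
  by rewrite subrr.
apply: (@continuous_closure_ge K (fun s => h s - h' s)) => // [s|s /hK ->].
  by apply: cvgB; [exact: hc|exact: hc'].
by rewrite subrr.
Qed.

Lemma sqr_sum_continuous (f g : T -> R) : continuous f -> continuous g ->
  continuous (fun t => f t ^+ 2 + g t ^+ 2).
Proof.
move=> fc gc t; apply: cvgD; apply: cvgM; try exact: fc.
  exact: gc.
exact: gc.
Qed.

Lemma cst_fun_continuous (c : R) : continuous (fun _ : T => c).
Proof. by move=> t; exact: cvg_cst. Qed.

Lemma oppr_fun_continuous h : continuous h -> continuous (fun t => - h t).
Proof. by move=> hc t; apply: cvgN; exact: hc. Qed.

End ContinuousOn.

Section StateSpace.
Variables (R : realType) (G : groupType).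

(* States are encoded by the family of their real and imaginary parts, so that
   they form a subset of a product of copies of [R]. *)
Local Notation T := {ptws (G * bool)%type -> R}.

Definition state_fun (u : T) (g : G) : R[i] := u (g, false) +i* u (g, true).
Definition state_coord (phi : G -> R[i]) : T :=
  fun i => if i.2 then complex.Im (phi i.1) else complex.Re (phi i.1).
Definition state_space : set T := [set u | is_state (state_fun u)].

Lemma state_coordK phi : state_fun (state_coord phi) = phi.
Proof. by apply/funext => g; rewrite /state_fun /state_coord /=; case: (phi g). Qed.

Definition state_eval (c : seq (R[i] * G)) (u : T) : R :=
  complex.Re (group_form (state_fun u) c c).

(** Exhibits a finite linear combination of coordinates, from which continuity and affinity are both
    read off. *)
Lemma state_evalE c u : state_eval c u = \sum_(x <- c) \sum_(y <- c)
  (complex.Re (x.1 * Num.conj y.1) * u ((y.2^-1 * x.2)%g, false)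
   - complex.Im (x.1 * Num.conj y.1) * u ((y.2^-1 * x.2)%g, true)).
Proof.
rewrite /state_eval /group_form raddf_sum; apply: eq_bigr => x _.
rewrite raddf_sum; apply: eq_bigr => y _ /=.
by rewrite /state_fun; case: (x.1 * Num.conj y.1).
Qed.

Lemma coord_continuous (i : G * bool) : continuous (fun u : T => u i).
Proof. exact: (@proj_continuous _ (fun _ => R)). Qed.

Lemma state_eval_continuous c : continuous (state_eval c).
Proof.
have -> : state_eval c = (fun u => \sum_(x <- c) \sum_(y <- c)
    (complex.Re (x.1 * Num.conj y.1) * u ((y.2^-1 * x.2)%g, false)
     - complex.Im (x.1 * Num.conj y.1) * u ((y.2^-1 * x.2)%g, true))).
  by apply/funext => u; rewrite state_evalE.
apply: sum_continuous => x; apply: sum_continuous => y.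
by apply: lincomb_continuous; exact: coord_continuous.
Qed.

Lemma state_spaceP u : state_space u <-> [/\ u (1%g, false) = 1, u (1%g, true) = 0,
  forall g, u (g^-1%g, false) = u (g, false),
  forall g, u (g^-1%g, true) = - u (g, true) &
  forall c, 0 <= state_eval c u].
Proof.
split=> [[u1 uV u0]|[u1 u1' uV uV' u0]].
  by case: u1 => u1 u1'; split => // g; case: (uV g).
split=> //; first by rewrite /state_fun u1 u1'.
by move=> g; rewrite /state_fun uV uV'.
Qed.

Lemma state_space_closed : closed state_space.
Proof.
move=> u cu.
apply/state_spaceP; split.
- apply: (continuous_closure_eq (@coord_continuous _) (@cst_fun_continuous _ _ 1) cu).
  by move=> s /state_spaceP[].
- apply: (continuous_closure_eq (@coord_continuous _) (@cst_fun_continuous _ _ 0) cu).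
  by move=> s /state_spaceP[].
- move=> g.
  apply: (continuous_closure_eq (@coord_continuous _) (@coord_continuous _) cu).
  by move=> s /state_spaceP[].
- move=> g.
  apply: (continuous_closure_eq (@coord_continuous _)
    (oppr_fun_continuous (@coord_continuous _)) cu).
  by move=> s /state_spaceP[].
- move=> c; apply: (continuous_closure_ge (@state_eval_continuous c) cu).
  by move=> s /state_spaceP[].
Qed.

(** Cauchy-Schwarz in the GNS space, where [phi] is the coefficient of a unit vector. *)
Lemma state_norm_le1 (phi : G -> R[i]) g : is_state phi -> `|phi g| <= 1.
Proof.
move=> hphi; rewrite (gns_state hphi); apply: le_trans (hdot_CS _ _) _.
rewrite rep_norm -expr2 hilbert_normE -[X in hdot _ X _](rep1 (gns_rep hphi)).
by rewrite -gns_state; case: hphi => ->.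
Qed.

Lemma state_coord_le1 u i : state_space u -> -1 <= u i <= 1.
Proof.
move=> hu; have := state_norm_le1 i.1 hu; rewrite -ler_norml => h.
case: i h => g [] h; [exact: (ler_ImC h)|exact: (ler_ReC h)].
Qed.

Lemma state_space_compact : compact state_space.
Proof.
apply: (subclosed_compact state_space_closed
  (@tychonoff _ (fun _ : G * bool => R) (fun _ => `[-1, 1]%classic) _)).
  by move=> i; exact: segment_compact.
by move=> u hu i /=; rewrite in_itv /= state_coord_le1.
Qed.

(** The convex combination is a point [u] described by its coordinates, so no vector space structure
    on the product is called for. *)
Definition affine_on (h : T -> R) := forall a b u (s : R), state_space a ->
  state_space b -> state_space u -> 0 < s < 1 ->
  (forall i, u i = s * a i + (1 - s) * b i) -> h u = s * h a + (1 - s) * h b.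

Definition admissible : set (T -> R) :=
  [set h | cont_on state_space h /\ affine_on h].

Lemma admissible_gsum (M : R) (y : nat -> T -> R) : (forall k, admissible (y k)) ->
  (forall k t, state_space t -> 0 <= y k t <= M) -> admissible (fun t => gsum (y^~ t)).
Proof.
move=> hy yM; split; first by apply: (cont_on_gsum _ yM) => k; case: (hy k).
move=> a b u s Ka Kb Ku s01 us.
rewrite -(gsum_lin s (1 - s) (fun k => yM k a Ka) (fun k => yM k b Kb)).
congr gsum; apply/funext => k; case: (hy k) => _ yk; exact: yk.
Qed.

Lemma state_eval_admissible c : admissible (state_eval c).
Proof.
split; first by apply: cont_onT; exact: state_eval_continuous.
move=> a b u s _ _ _ _ us; rewrite !state_evalE !mulr_sumr -big_split.
apply: eq_bigr => x _; rewrite !mulr_sumr -big_split; apply: eq_bigr => y _ /=.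
by rewrite !us; ring.
Qed.

Hypothesis G_countable : countable [set: G]%classic.

Lemma countable_enum : exists (e : nat -> G) (f : G -> nat), forall g, e (f g) = g.
Proof.
have /countable_injP[f finj] := G_countable.
exists (fun n => xget 1%g [set g | f g = n]), f => g.
case: xgetP => [h _ /= fh|/(_ g)/(_ erefl)//].
by apply: finj => //; rewrite inE.
Qed.

(* A maximum over a face of a strictly convex function is an extreme point. *)
Lemma max_extreme h : state_space !=set0 -> admissible h ->
  exists b, [/\ extreme_state (state_fun b), state_space b &
    forall t, state_space t -> h t <= h b].
Proof.
move=> K0 [hc haff].
have [e [f ef]] := countable_enum.
have [c0 /[!inE] Kc0 c0max] :=
  compact_EVT_max K0 state_space_compact (cont_on_within hc).
(* The maximum points of [h], a closed face of the states as [h] is affine. *)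
pose K1 := [set t | state_space t /\ h c0 <= h t].
have K1K : K1 `<=` state_space by move=> t [].
have K1cl : closed K1.
  move=> t ct; have Kt : state_space t.
    by apply: state_space_closed; apply: closureS ct.
  by split => //; apply: (closure_ge hc K1K ct Kt) => s [].
have K1c : compact K1 := subclosed_compact K1cl state_space_compact K1K.
pose sq (t : T) k := t (e k, false) ^+ 2 + t (e k, true) ^+ 2.
have sq_le (t : T) k : (forall i, -1 <= t i <= 1) -> 0 <= sq t k <= 2.
  move=> ht; rewrite addr_ge0 ?sqr_ge0 //=.
  have sq1 (r : R) : -1 <= r <= 1 -> r ^+ 2 <= 1.
    by rewrite -ler_norml => r1; rewrite -real_normK ?num_real // exprn_ile1.
  by have := sq1 _ (ht (e k, false)); have := sq1 _ (ht (e k, true)); rewrite /sq; lra.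
have sqM k t : state_space t -> 0 <= sq t k <= 2.
  by move=> Kt; apply: sq_le => i; exact: state_coord_le1.
(* Strictly convex, since the enumeration [e] reaches every group element, and continuous on the
   states, since the terms are at most 2 there. *)
pose q t := gsum (sq t).
have qc : cont_on state_space q.
  apply: (@cont_on_gsum R T state_space (fun k t => sq t k) 2 _ sqM) => k.
  apply: cont_onT.
  by apply: sqr_sum_continuous; exact: coord_continuous.
have K10 : K1 !=set0 by exists c0.
have [b /[!inE] -[Kb hb] bmax] :=
  compact_EVT_max K10 K1c (cont_on_within (cont_on_sub K1K qc)).
have hmax t : state_space t -> h t <= h b.
  by move=> Kt; apply: le_trans hb; apply: c0max; rewrite inE.
exists b; split => //; split => // al be s hal hbe /andP[s0 s1] dec.
pose a1 := state_coord al; pose b1 := state_coord be.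
have Ka1 : state_space a1 by rewrite /state_space /= state_coordK.
have Kb1 : state_space b1 by rewrite /state_space /= state_coordK.
have bs i : b i = s * a1 i + (1 - s) * b1 i.
  case: i => g []; have := dec g; rewrite -(state_coordK al) -(state_coordK be).
    move=> /(congr1 (@complex.Im R)) /=; rewrite /a1 /b1 => ->.
    by rewrite !mul0r !addr0.
  move=> /(congr1 (@complex.Re R)) /=; rewrite /a1 /b1 => ->.
  by rewrite !mul0r !subr0.
have s01 : 0 < s < 1 by rewrite s0.
have hE := haff a1 b1 b s Ka1 Kb1 Kb s01 bs.
have ha1 := hmax _ Ka1; have hb1 := hmax _ Kb1.
have s1' : 0 < 1 - s by rewrite subr_gt0.
have pa : s * h a1 <= s * h b by rewrite ler_pM2l.
have pb : (1 - s) * h b1 <= (1 - s) * h b by rewrite ler_pM2l.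
(* The value at [b] is a proper mean of two values that do not exceed it, so both components lie in
   the face. *)
have ea : h b <= h a1 by rewrite -(ler_pM2l s0); lra.
have eb : h b <= h b1 by rewrite -(ler_pM2l s1'); lra.
have qa : q a1 <= q b by apply: bmax; rewrite inE; split=> //; exact: le_trans ea.
have qb : q b1 <= q b by apply: bmax; rewrite inE; split=> //; exact: le_trans eb.
(* Halving keeps the coordinates in [[-1, 1]], hence the bound 2 again. The factor 4 below undoes it
   in [s a^2 + (1-s) b^2 = (s a + (1-s) b)^2 + s (1-s) (a-b)^2]. *)
pose d i := (a1 i - b1 i) / 2.
have dM k : 0 <= sq d k <= 2.
  apply: sq_le => i; rewrite /d.
  by have := state_coord_le1 i Ka1; have := state_coord_le1 i Kb1; lra.
have qE : q a1 * s + q b1 * (1 - s) = q b + 4 * s * (1 - s) * gsum (sq d).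
  rewrite -[q b]mul1r -(gsum_lin _ _ (fun k => sqM k b Kb) dM).
  rewrite mulrC [X in _ + X]mulrC.
  rewrite -(gsum_lin _ _ (fun k => sqM k a1 Ka1) (fun k => sqM k b1 Kb1)).
  by congr gsum; apply/funext => k; rewrite /sq !bs /d; field.
have gd : gsum (sq d) <= 0.
  have p : 0 < 4 * s * (1 - s) by rewrite !mulr_gt0.
  rewrite -(ler_pM2l p) mulr0.
  have := qE; have : s * q a1 <= s * q b by rewrite ler_pM2l.
  have : (1 - s) * q b1 <= (1 - s) * q b by rewrite ler_pM2l.
  move: (4 * s * (1 - s) * _) => z; lra.
have ab i : a1 i = b1 i.
  case: i => g bb; have := gsum_eq0 (f g) dM gd; rewrite /sq ef => /eqP.
  rewrite paddr_eq0 ?sqr_ge0 // !sqrf_eq0 => /andP[/eqP d0 /eqP d1].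
  have : d (g, bb) = 0 by case: bb.
  by rewrite /d; lra.
move=> g; rewrite -(state_coordK al) -/a1.
by rewrite /state_fun !bs !ab; congr (_ +i* _); ring.
Qed.

End StateSpace.

(** * Norm convergence of averages *)

Section StrongConvergence.
Variables (R : realType) (G : groupType).

Definition average_list (A : {fset G}) : seq (R[i] * G) :=
  [seq ((#|` A|%:R)^-1, s) | s <- A].

Definition average_diff (A D : {fset G}) : seq (R[i] * G) :=
  average_list A ++ group_scale (-1) (average_list D).

Section Rep.
Variables (H : hilbertType R) (pi : unitary_rep G H).

Lemma average_diff_act A D v :
  group_act pi (average_diff A D) v = rep_average pi A v - rep_average pi D v.
Proof.
rewrite /group_act /average_diff big_cat /group_scale /average_list !big_map /=.
rewrite /rep_average !scaler_sumr -sumrN; congr (_ + _).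
by apply: eq_bigr => s _; rewrite mulN1r scaleNr.
Qed.

Lemma state_eval_average_diff u A D v :
  (forall g, state_fun u g = hdot H (pi g v) v) ->
  state_eval (average_diff A D) u = hsq (rep_average pi A v - rep_average pi D v).
Proof.
by move=> hu; rewrite /state_eval (group_form_act _ hu) average_diff_act.
Qed.

Lemma rep_average_norm A v : hnorm (rep_average pi A v) <= hnorm v.
Proof.
rewrite -lecR -!hnormE /rep_average normrZ card_inv_real.
have [->|A0] := eqVneq #|` A| 0%N; first by rewrite invr0 mul0r normr_ge0.
have h : `|\sum_(s <- A) pi s v| <= (#|` A|%:R * hnorm v)%:C.
  by apply: norm_sum_fset => s; rewrite rep_norm hnormE.
apply: le_trans (ler_wpM2l _ h) _; first by rewrite ler0c invr_ge0 ler0n.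
by rewrite -rmorphM mulrA mulVf ?pnatr_eq0 // mul1r hnormE lexx.
Qed.

(** The constant is [(1 + 1)^2], as averages are contractions. *)
Lemma hsq_average_diff_le A D v : hsq v = 1 ->
  hsq (rep_average pi A v - rep_average pi D v) <= 4.
Proof.
move=> v1; have n1 : hnorm v = 1 by rewrite /hnorm /ph_norm -/(hsq v) v1 sqrtr1.
have hA := rep_average_norm A v; have hD := rep_average_norm D v.
have h : hnorm (rep_average pi A v - rep_average pi D v) <= 2.
  rewrite -lecR -hnormE; apply: le_trans (ler_normB _ _) _.
  by rewrite !hnormE -rmorphD lecR; lra.
rewrite -hnorm_sqr; have := hnorm_ge0 (rep_average pi A v - rep_average pi D v).
by move: h; move: (hnorm _) => r; nra.
Qed.

End Rep.

Lemma state_eval_bound A D u : state_space u ->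
  0 <= state_eval (average_diff A D) u <= 4.
Proof.
move=> hu; rewrite (state_eval_average_diff A D (gns_state hu)) hsq_ge0 /=.
apply: hsq_average_diff_le; apply: complexI.
by rewrite -hsqE -[X in hdot _ X _](rep1 (gns_rep hu)) -gns_state; case: hu => ->.
Qed.

Variables (G_countable : countable [set: G]%classic) (G_moore : moore_group R G).
Variables (F : nat -> {fset G}) (F_folner : left_folner R F).

Lemma extreme_average_diff b (m n : nat -> nat) :
  (forall k, (k <= m k)%N) -> (forall k, (k <= n k)%N) ->
  extreme_state (state_fun b) -> forall e : R, 0 < e ->
  exists N, forall k, (N <= k)%N ->
    state_eval (average_diff (F (m k)) (F (n k))) b <= e.
Proof.
move=> hm hn hb e e0.
have [H [pi [xi [hxi [l hl]]]]] := extreme_state_average_cvg G_moore F_folner hb.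
(* The evaluation to be bounded by [e] is a squared norm, and the triangle inequality through [l]
   uses two halves. *)
have d0 : 0 < Num.sqrt e / 2 by rewrite divr_gt0 // sqrtr_gt0.
have [N hN] := (cvgC_P _ _).1 hl _ d0.
exists N => k Nk; rewrite (state_eval_average_diff _ _ hxi).
have h1 := hN _ (leq_trans Nk (hm k)); have h2 := hN _ (leq_trans Nk (hn k)).
rewrite -hnorm_sqr -[leRHS](sqr_sqrtr (ltW e0)) ler_sqr ?nnegrE ?hnorm_ge0 ?sqrtr_ge0 //.
rewrite -lecR -hnormE (splitr (Num.sqrt e)) rmorphD.
have -> : rep_average pi (F (m k)) xi - rep_average pi (F (n k)) xi =
  (l - rep_average pi (F (n k)) xi) - (l - rep_average pi (F (m k)) xi).
  by rewrite opprB [RHS]addrC addrA subrK.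
by apply: le_trans (ler_normB _ _) _; apply: lerD; exact: ltW.
Qed.

Lemma unit_average_cvg (H : hilbertType R) (pi : unitary_rep G H) (v : H) :
  hsq v = 1 -> exists l : H, rep_average pi (F n) v @[n --> \oo] --> l.
Proof.
move=> v1; apply: cauchyC_cvg => e e0; apply: contrapT => noN.
(* Both indices go beyond [k], so wherever the averages converge the differences along [mn] still
   tend to 0. *)
have /choice[mn hmn] k : exists mn : nat * nat, [/\ (k <= mn.1)%N, (k <= mn.2)%N &
    e <= hnorm (rep_average pi (F mn.1) v - rep_average pi (F mn.2) v)].
  apply: contrapT => nok; apply: noN; exists k => m n km kn.
  rewrite hnormE ltcR ltNge; apply/negP => h; apply: nok.
  by exists (m, n).
pose u0 := state_coord (fun g => hdot H (pi g v) v).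
have u0E : state_fun u0 = (fun g => hdot H (pi g v) v) by exact: state_coordK.
have Ku0 : state_space u0.
  by rewrite /state_space /= u0E; apply: vector_state.
(* At [u0] the evaluations are squared norms of the differences, whence the lower bound [e ^+ 2]. *)
apply: (@simons R _ (@state_space R G) u0 [set b | extreme_state (state_fun b)]
  (@admissible R G) 4 (e ^+ 2)
  (fun k => state_eval (average_diff (F (mn k).1) (F (mn k).2)))).
- exact: Ku0.
- by rewrite exprn_gt0.
- by move=> k; exact: state_eval_admissible.
- by move=> k t; exact: state_eval_bound.
- by move=> y; exact: admissible_gsum.
- move=> h hadm _; apply: (max_extreme G_countable) => //.
  by exists u0.
- move=> k; have [_ _ h] := hmn k.
  rewrite (@state_eval_average_diff H pi _ _ _ v) ?u0E //.
  by rewrite -hnorm_sqr ler_sqr // nnegrE ?hnorm_ge0 // (ltW e0).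
- move=> b hb _; apply: (extreme_average_diff (m := fun k => (mn k).1)
    (n := fun k => (mn k).2)) => // k; by have [] := hmn k.
Qed.

Lemma average_cvg (H : hilbertType R) (pi : unitary_rep G H) (v : H) :
  exists l : H, rep_average pi (F n) v @[n --> \oo] --> l.
Proof.
have [->|v0] := eqVneq v 0.
  exists 0; have -> : (fun n => rep_average pi (F n) 0) = (fun=> 0).
    apply/funext => n; rewrite /rep_average big1 ?scaler0 // => s _.
    by rewrite linear0.
  exact: cvg_cst.
have n0 : 0 < hnorm v.
  rewrite lt_neqAle hnorm_ge0 andbT eq_sym; apply: contra_neq v0 => nv.
  by apply: hsq_eq0; rewrite -hnorm_sqr nv expr0n.
pose w := (hnorm v)^-1%:C *: v.
have [|l hl] := @unit_average_cvg H pi w.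
  rewrite hsqZ /= [0 ^+ 2]mulr0 addr0 -hnorm_sqr -exprMn mulVf ?expr1n //.
  by rewrite gt_eqF.
exists ((hnorm v)%:C *: l).
have -> : (fun n => rep_average pi (F n) v) =
    (fun n => (hnorm v)%:C *: rep_average pi (F n) w).
  apply/funext => n; rewrite /rep_average scalerA mulrC -scalerA; congr (_ *: _).
  rewrite scaler_sumr; apply: eq_bigr => s _.
  by rewrite linearZ /= scalerA -rmorphM mulfV ?gt_eqF // scale1r.
by apply: cvgZl_tmp.
Qed.

End StrongConvergence.

Theorem corollary1p2 (R : realType) (G : groupType)
    (G_countable : countable [set: G]%classic) (G_moore : moore_group R G)
    (F : nat -> {fset G}) (F_folner : left_folner R F)
    (H : hilbertType R) (pi : unitary_rep G H) :
  strong_sequence pi F.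
Proof.
move=> v; have [l hl] := average_cvg G_countable G_moore F_folner pi v.
by rewrite -(average_lim_eq F_folner hl).
Qed.
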